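(* (i) $\mathfrak{L}(\mathbb{Q}^+)^w_{O(n)} \subsetneq \mathfrak{L}(SL(2,\mathbb{Q}))^w_{O(n)}$. (ii) $\mathfrak{L}(\mathbb{Z})^w_{O(n)} \subsetneq \mathfrak{L}(BS(1,2))^w_{O(n)}$ and $\mathfrak{L}(BS(1,2))^w_{O(n)}\not\subseteq\mathsf{CF}$. (iii) $\mathfrak{L}(SL(2,\mathbb{Z}))^w_{O(n)} \subsetneq \mathfrak{L}(SL(3,\mathbb{Z}))^w_{O(n)}$. (iv) $\mathfrak{L}(\mathbb{Z}^2)^w_{O(n)} \subsetneq \mathfrak{L}(\mathbf{H})^w_{O(n)}$. (v) For all $k\ge2$, $\mathsf{CF}$ and $\mathfrak{L}(\mathbb{Z}^k)^w_{O(n)}$ are incomparable. (vi) $\mathfrak{L}(SL(3,\mathbb{Z}))^w_{O(n)} = \mathfrak{L}(GL(3,\mathbb{Z}))^w_{O(n)}$. (vii) $\mathsf{REG} = \mathfrak{L}(\mathbf{F}_0)^w_{O(n)} \subsetneq \mathfrak{L}(\mathbf{F}_1)^w_{O(n)} = \mathfrak{L}(\mathbb{Z})^w_{O(n)} \subsetneq \mathfrak{L}(\mathbf{F}_2)^w_{O(n)}$.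
   Context: For a group $G$ with identity $e$, a $G$-automaton is a tuple $(Q,\Sigma,G,\delta,q_0,Q_a)$ where $Q$ is a finite set of states, $\Sigma$ a finite input alphabet, $q_0\in Q$ the initial state, $Q_a\subseteq Q$ the accepting states, and $\delta$ assigns to each $(q,\sigma)\in Q\times(\Sigma\cup\{\varepsilon\})$ a finite set of pairs $(q',m)\in Q\times G$. The register holds an element of $G$, initially $e$; using a transition $(q',m)\in\delta(q,\sigma)$ (one step) the automaton reads $\sigma$ (or nothing), moves to $q'$ and replaces the register content $x$ by $xm$. A word is accepted if some computation reads it entirely and ends in an accepting state with register equal to $e$. A $G$-automaton recognizing $\mathtt{L}$ is weakly $t(n)$ time-bounded if every $x\in\mathtt{L}$ with $|x|=n$ has an accepting computation of at most $t(n)$ steps; $\mathfrak{L}(G)^w_{O(n)}$ is the class of languages recognized by weakly $t(n)$ time-bounded $G$-automata for some $t(n)=O(n)$. Notation: $\mathbb{Q}^+$ is the multiplicative group of positive rationals; $SL(n,R)$ and $GL(n,\mathbb{Z})$ are the groups of $n\times n$ matrices over $R$ with determinant $1$, resp. integer matrices with determinant $\pm1$; $BS(1,2)=\langle a,b\mid bab^{-1}=a^2\rangle$; $\mathbf{H}$ is the discrete Heisenberg group of $3\times3$ upper unitriangular integer matrices; $\mathbb{Z}^k$ is the free Abelian group of rank $k$; $\mathbf{F}_r$ is the free group of rank $r$ ($\mathbf{F}_0$ trivial); $\mathsf{REG}$ and $\mathsf{CF}$ are the classes of regular and context-free languages. *)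

(* Defs.v *)
From HB Require Import structures.
From mathcomp Require Import all_boot all_order all_algebra.
From Stdlib Require Relations List.
Unset Printing Implicit Defensive.
Import GRing.Theory Num.Theory.
Local Open Scope ring_scope.

(* A group G, as used by G-automata: a carrier type together with the  *)
(* subset of the carrier that constitutes the group, the group         *)
(* multiplication, the identity e, and the equality of group elements  *)
(* (Leibniz equality for concrete groups, the congruence of the        *)
(* presentation for groups given by generators and relations).         *)
(* Only multiplication, identity and equality enter the definition of  *)
(* G-automata, so inverses are not recorded.                            *)
Record grp := Grp {
  gcar : Type;
  gmem : gcar -> Prop;
  gmul : gcar -> gcar -> gcar;
  gone : gcar;
  geq  : gcar -> gcar -> Prop }.

Record gaut (G : grp) (Sigma : finType) := GAut {
  gQT : finType;
  gq0 : gQT;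
  gacc : pred gQT;
  gdelta : gQT -> option Sigma -> seq (gQT * gcar G); (* None = epsilon *)
  gdelta_mem : forall q a q' m, List.In (q', m) (gdelta q a) -> gmem G m }.
Arguments gQT {G Sigma}.
Arguments gq0 {G Sigma}.
Arguments gacc {G Sigma}.
Arguments gdelta {G Sigma}.

Inductive runs (G : grp) (Sigma : finType) (A : gaut G Sigma) :
  gQT A -> gcar G -> seq Sigma -> gQT A -> gcar G -> nat -> Prop :=
| run_nil q x : runs G Sigma A q x [::] q x 0
| run_eps q x q1 m w q' y n :
    List.In (q1, m) (gdelta A q None) ->
    runs G Sigma A q1 (gmul G x m) w q' y n -> runs G Sigma A q x w q' y n.+1
| run_sym q x a q1 m w q' y n :
    List.In (q1, m) (gdelta A q (Some a)) ->
    runs G Sigma A q1 (gmul G x m) w q' y n -> runs G Sigma A q x (a :: w) q' y n.+1.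
Arguments runs {G Sigma}.

Definition accepts_in (G : grp) (Sigma : finType) (A : gaut G Sigma)
  (w : seq Sigma) (n : nat) : Prop :=
  exists (qf : gQT A) (y : gcar G),
    runs A (gq0 A) (gone G) w qf y n /\ gacc A qf /\ geq G y (gone G).

Definition gaccepts (G : grp) (Sigma : finType) (A : gaut G Sigma)
  (w : seq Sigma) : Prop := exists n, accepts_in G Sigma A w n.

Definition bigO_n (t : nat -> nat) : Prop :=
  exists c N : nat, forall n, (N <= n)%N -> (t n <= c * n)%N.

Definition lang_class := forall Sigma : finType, (seq Sigma -> Prop) -> Prop.

Definition LGw (G : grp) : lang_class := fun Sigma L =>
  exists (A : gaut G Sigma) (t : nat -> nat),
    bigO_n t /\
    (forall w, L w <-> gaccepts G Sigma A w) /\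
    (forall w, L w -> exists n, (n <= t (size w))%N /\ accepts_in G Sigma A w n).

Definition REG : lang_class := fun Sigma L =>
  exists (Q : finType) (s : Q) (F : pred Q) (d : Q -> Sigma -> Q),
    forall w, L w <-> F (foldl d s w).

Inductive derives (N Sigma : Type) (P : seq (N * seq (N + Sigma))) :
  seq (N + Sigma) -> seq Sigma -> Prop :=
| der_nil : derives N Sigma P [::] [::]
| der_term a s w : derives N Sigma P s w -> derives N Sigma P (inr a :: s) (a :: w)
| der_nt X rhs s u v : List.In (X, rhs) P -> derives N Sigma P rhs u ->
    derives N Sigma P s v -> derives N Sigma P (inl X :: s) (u ++ v).

Definition CF : lang_class := fun Sigma L =>
  exists (N : finType) (S : N) (P : seq (N * seq (N + Sigma))),
    forall w, L w <-> derives N Sigma P [:: inl S] w.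

Definition csub (C1 C2 : lang_class) : Prop :=
  forall (Sigma : finType) (L : seq Sigma -> Prop), C1 Sigma L -> C2 Sigma L.
Definition ceq (C1 C2 : lang_class) : Prop := csub C1 C2 /\ csub C2 C1.
Definition cstrict (C1 C2 : lang_class) : Prop :=
  csub C1 C2 /\ exists (Sigma : finType) (L : seq Sigma -> Prop), C2 Sigma L /\ ~ C1 Sigma L.
Definition cincomparable (C1 C2 : lang_class) : Prop := ~ csub C1 C2 /\ ~ csub C2 C1.

Definition zmod_grp (V : zmodType) : grp := Grp V (fun _ => True) +%R 0 eq.

Definition mat_grp (R : comNzRingType) (n : nat) (P : 'M[R]_n -> Prop) : grp :=
  Grp 'M[R]_n P (@mulmx R n n n) 1%:M eq.

Definition Qplus : grp := Grp rat (fun x => 0 < x) *%R 1 eq.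
Definition SL (R : comNzRingType) (n : nat) : grp := mat_grp R n (fun A : 'M[R]_n => \det A = 1).
Definition GLZ (n : nat) : grp :=
  mat_grp int n (fun A : 'M[int]_n => \det A = 1 \/ \det A = -1).
Definition Heis : grp :=
  mat_grp int 3 (fun A : 'M[int]_3 =>
    (forall i, A i i = 1) /\ (forall i j : 'I_3, (j < i)%N -> A i j = 0)).
Definition Zgrp : grp := zmod_grp int.
Definition Zk (k : nat) : grp := zmod_grp 'rV[int]_k.

(* groups given by presentations <X | Rel>: words over X and the formal
   inverses (letter (x, false) = x, (x, true) = x^-1), modulo the congruence
   generated by inserting x x^-1, x^-1 x, relators and inverse relators *)
Definition linv (X : Type) (l : X * bool) : X * bool := (l.1, ~~ l.2).
Definition winv (X : Type) (w : seq (X * bool)) : seq (X * bool) := rev (map (linv X) w).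

Inductive pstep (X : Type) (Rel : seq (seq (X * bool))) :
  seq (X * bool) -> seq (X * bool) -> Prop :=
| pstep_free u w (x : X) b : pstep X Rel (u ++ w) (u ++ [:: (x, b); (x, ~~ b)] ++ w)
| pstep_rel u w r : List.In r Rel -> pstep X Rel (u ++ w) (u ++ r ++ w)
| pstep_relinv u w r : List.In r Rel -> pstep X Rel (u ++ w) (u ++ winv X r ++ w).

Definition peq (X : Type) (Rel : seq (seq (X * bool))) :=
  Relation_Operators.clos_refl_sym_trans _ (pstep X Rel).

Definition pres_grp (X : Type) (Rel : seq (seq (X * bool))) : grp :=
  Grp (seq (X * bool)) (fun _ => True) cat [::] (peq X Rel).

Definition Free (r : nat) : grp := pres_grp 'I_r [::].

(* BS(1,2) = < a, b | b a b^-1 = a^2 >, generators a = false, b = true;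
   relator b a b^-1 a^-1 a^-1 *)
Definition BS12 : grp :=
  pres_grp bool [:: [:: (true, false); (false, false); (true, true);
                   (false, true); (false, true)]].

(* Main.v *)
Require Import Defs.
From mathcomp Require Import all_boot all_order all_algebra.
From mathcomp Require Import zify ring.
From Stdlib Require Relations List.
Import Defs.
Set Implicit Arguments.
Unset Strict Implicit.
Unset Printing Implicit Defensive.
Import Order.TTheory GRing.Theory Num.Theory.
Local Open Scope ring_scope.

(* All inclusions are simulations: a map of the registers (for GL(3,Z) together
   with a bit for the determinant, -1 being central of determinant -1) that
   preserves multiplication and reflects the identity.

   Separations are of two kinds. A fooling set u_i, v_i for a language (u_i v_j
   is in it only for i = j) needs as many configurations reachable within the
   time bound as it has elements. In a commutative group the configuration is
   determined by the number of uses of each transition, which leaves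
   polynomially many; the affine maps t -> 4t and t -> 4t + 1 generate a free
   monoid and act through SL(2,Q), BS(1,2) and F_2, whose word problems thus
   have exponential fooling sets, as do the palindromes. For Z^2 there are
   O(n^2) configurations against n^3 elements x^i y^j z^k of H.

   The other separations use the pumping lemma, which fails for a^(2^n)
   (recognized over BS(1,2) by b^i a b^(-i) = a^(2^i)) and for a^n b^n c^n
   (recognized over Z^2). It holds for SL(2,Z): as this group is the amalgam of
   <S> and <U> over {+-1}, a path in its Cayley graph between two elements of
   <S> u <U> can be cut at an inner point into two such paths, so that the runs
   are the derivations of a binary grammar with labels (state, element, state). *)

(** * Simulations *)

Lemma runs_cat (G : grp) (Sigma : finType) (A : gaut G Sigma) q x u q1 x1 n1 v q2 x2 n2 :
  runs A q x u q1 x1 n1 -> runs A q1 x1 v q2 x2 n2 ->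
  runs A q x (u ++ v) q2 x2 (n1 + n2)%N.
Proof.
move=> r1 r2; elim: r1 r2 => //= {q x u q1 x1 n1}.
- move=> q x q1 m w q' y n hin _ IH /IH; exact: run_eps.
- move=> q x a q1 m w q' y n hin _ IH /IH; exact: run_sym.
Qed.

Lemma runs_split (G : grp) (Sigma : finType) (A : gaut G Sigma) q x u v q2 x2 n :
  runs A q x (u ++ v) q2 x2 n ->
  exists q1 x1 n1 n2, [/\ runs A q x u q1 x1 n1, runs A q1 x1 v q2 x2 n2 & n = (n1 + n2)%N].
Proof.
move ew: (u ++ v) => w r; elim: r u v ew => {q x w q2 x2 n}.
- move=> q x [|//] [|//] _; exists q, x, 0%N, 0%N; split=> //; exact: run_nil.
- move=> q x q1 m w q' y n hin _ IH u v /IH[q3 [x3 [n1 [n2 [r1 r2 ->]]]]].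
  by exists q3, x3, n1.+1, n2; split=> //; apply: run_eps hin r1.
- move=> q x a q1 m w q' y n hin r IH [|b u] v /=.
  + move=> ->; exists q, x, 0%N, n.+1; split=> //; first exact: run_nil.
    exact: run_sym hin r.
  + case=> -> /IH[q3 [x3 [n1 [n2 [r1 r2 ->]]]]].
    by exists q3, x3, n1.+1, n2; split=> //; apply: run_sym hin r1.
Qed.

(** The finitely many lengths below the threshold are absorbed into the constant by adding the
    maximum of [t] over them; the successor leaves room for steps on the empty word. *)
Lemma LGwP (G : grp) (Sigma : finType) (L : seq Sigma -> Prop) :
  LGw G Sigma L <-> exists (A : gaut G Sigma) (c : nat),
    (forall w, L w <-> gaccepts G Sigma A w) /\
    (forall w, L w -> exists n, (n <= c * (size w).+1)%N /\ accepts_in G Sigma A w n).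
Proof.
split=> [[A [t [[c [N tb]] [recL timeL]]]]|[A [c [recL timeL]]]].
  exists A, (c + \max_(i < N) t i)%N; split=> // w /[dup] Lw /timeL[n [nt acc]].
  exists n; split=> //; apply: leq_trans nt _; case: (leqP N (size w)) => [/tb|lt_wN].
    move=> h; apply: leq_trans h _; apply: leq_mul => //; exact: leq_addr.
  apply: leq_trans (leq_bigmax (F := fun i : 'I_N => t i) (Ordinal lt_wN)) _.
  by apply: leq_trans (leq_addl c _) _; rewrite leq_pmulr.
exists A, (fun n => c * n.+1)%N; split=> //; exists (c * 2)%N, 1%N => n n1.
by rewrite -mulnA leq_mul2l; apply/orP; right; lia.
Qed.

Section Simulation.
Variables (G H : grp) (S : finType) (s0 : S) (ok : pred S).
Variables (next : S -> gcar G -> S) (f : gcar G -> gcar H).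
Variable R : S -> gcar G -> gcar H -> Prop.
Hypothesis memf : forall m, gmem G m -> gmem H (f m).
Hypothesis R0 : R s0 (gone G) (gone H).
Hypothesis RM : forall s x y m, gmem G m -> R s x y ->
  R (next s m) (gmul G x m) (gmul H y (f m)).
Hypothesis R1 : forall s x y, R s x y -> (geq G x (gone G) <-> ok s /\ geq H y (gone H)).
Variables (Sigma : finType) (A : gaut G Sigma).

(** States carry a finite memory in [S], updated by [next] from the group element of each transition
    and tested by [ok] at the end; [R] is the invariant tying the memory to the two registers. *)
Definition sim_delta (qs : gQT A * S) (a : option Sigma) : seq ((gQT A * S) * gcar H) :=
  [seq ((p.1, next qs.2 p.2), f p.2) | p <- gdelta A qs.1 a].

Lemma sim_deltaP qs a q1 s1 m1 :
  List.In ((q1, s1), m1) (sim_delta qs a) <->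
  exists m, [/\ List.In (q1, m) (gdelta A qs.1 a), s1 = next qs.2 m & m1 = f m].
Proof.
rewrite List.in_map_iff; split=> [[[q m] /= [[<- <- <-] hin]]|[m [hin -> ->]]].
  by exists m.
by exists (q1, m).
Qed.

Lemma sim_delta_mem qs a q m : List.In (q, m) (sim_delta qs a) -> gmem H m.
Proof.
case: q => q s /sim_deltaP[m0 [hin _ ->]]; apply: memf.
exact: (@gdelta_mem _ _ A _ _ _ _ hin).
Qed.

Definition sim_aut : gaut H Sigma :=
  GAut H Sigma _ (gq0 A, s0) [pred qs | gacc A qs.1 && ok qs.2] sim_delta sim_delta_mem.

Lemma sim_runs q x w q' y n s z : R s x z -> runs A q x w q' y n ->
  exists s' z', R s' y z' /\ runs sim_aut (q, s) z w (q', s') z' n.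
Proof.
move=> + r; elim: r s z => {q x w q' y n}.
- by move=> q x s z Rxz; exists s, z; split=> //; apply: run_nil.
- move=> q x q1 m w q' y n hin _ IH s z Rxz.
  have gm := @gdelta_mem _ _ A _ _ _ _ hin.
  have [s' [z' [Ryz r]]] := IH _ _ (RM gm Rxz).
  exists s', z'; split=> //; apply: run_eps r; apply/sim_deltaP; by exists m.
- move=> q x a q1 m w q' y n hin _ IH s z Rxz.
  have gm := @gdelta_mem _ _ A _ _ _ _ hin.
  have [s' [z' [Ryz r]]] := IH _ _ (RM gm Rxz).
  exists s', z'; split=> //; apply: run_sym r; apply/sim_deltaP; by exists m.
Qed.

Lemma sim_runs_inv qs z w qs' z' n x : R qs.2 x z -> runs sim_aut qs z w qs' z' n ->
  exists y, R qs'.2 y z' /\ runs A qs.1 x w qs'.1 y n.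
Proof.
move=> + r; elim: r x => {qs z w qs' z' n}.
- by move=> qs z x Rxz; exists x; split=> //; apply: run_nil.
- move=> qs z [q1 s1] m w qs' z' n /sim_deltaP[m0 [hin -> ->]] _ IH x Rxz.
  have gm := @gdelta_mem _ _ A _ _ _ _ hin.
  have [y [Ryz r]] := IH _ (RM gm Rxz).
  by exists y; split=> //; apply: run_eps r.
- move=> qs z a [q1 s1] m w qs' z' n /sim_deltaP[m0 [hin -> ->]] _ IH x Rxz.
  have gm := @gdelta_mem _ _ A _ _ _ _ hin.
  have [y [Ryz r]] := IH _ (RM gm Rxz).
  by exists y; split=> //; apply: run_sym r.
Qed.

(** Steps correspond one to one, so a time bound carries over unchanged. *)
Lemma sim_accepts w n : accepts_in G Sigma A w n <-> accepts_in H Sigma sim_aut w n.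
Proof.
split=> [[qf [y [r [acc yE]]]]|[[qf sf] [z [r [/= /andP[acc oks] zE]]]]].
  have [s' [z' [/R1[+ _] r']]] := sim_runs R0 r; move=> /(_ yE)[oks zE].
  by exists (qf, s'), z'; split=> //=; rewrite acc oks.
have [y [/R1[_ +] r']] := sim_runs_inv (qs := (_, _)) R0 r.
by move=> /(_ (conj oks zE)) yE; exists qf, y.
Qed.

End Simulation.

Lemma LGw_simulation (G H : grp) (S : finType) (s0 : S) (ok : pred S)
    (next : S -> gcar G -> S) (f : gcar G -> gcar H) (R : S -> gcar G -> gcar H -> Prop) :
  (forall m, gmem G m -> gmem H (f m)) ->
  R s0 (gone G) (gone H) ->
  (forall s x y m, gmem G m -> R s x y -> R (next s m) (gmul G x m) (gmul H y (f m))) ->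
  (forall s x y, R s x y -> (geq G x (gone G) <-> ok s /\ geq H y (gone H))) ->
  csub (LGw G) (LGw H).
Proof.
move=> memf R0 RM R1 Sigma L [A [t [tO [recL timeL]]]].
pose A' := @sim_aut G H S s0 ok next f memf Sigma A; exists A', t.
have accE w n := @sim_accepts G H S s0 ok next f R memf R0 RM R1 Sigma A w n.
split=> //; split=> w.
  rewrite recL; split=> -[n] acc; exists n; exact/accE.
by move/timeL=> [n [nt acc]]; exists n; split=> //; apply/accE.
Qed.

Lemma LGw_hom (G H : grp) (f : gcar G -> gcar H) (R : gcar G -> gcar H -> Prop) :
  (forall m, gmem G m -> gmem H (f m)) ->
  R (gone G) (gone H) ->
  (forall x y m, gmem G m -> R x y -> R (gmul G x m) (gmul H y (f m))) ->
  (forall x y, R x y -> (geq G x (gone G) <-> geq H y (gone H))) ->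
  csub (LGw G) (LGw H).
Proof.
move=> memf R0 RM R1.
apply: (@LGw_simulation G H unit tt predT (fun _ _ => tt) f (fun _ => R)) => // s x y /R1.
by case=> h1 h2; split=> [/h1|[_ /h2]].
Qed.

(** The map from [m] to [\det m *: m] is multiplicative and, in dimension 3, has values of
    determinant [(\det m) ^ 4 = 1]. Its kernel on GL(3,Z) is {+-1}; the boolean memory, which is the
    sign of the determinant, tells these two elements apart. *)
Lemma LGw_GLZ3_SL3 : ceq (LGw (SL int 3)) (LGw (GLZ 3)).
Proof.
split.
  apply: (@LGw_hom (SL int 3) (GLZ 3) id eq) => //=; first by move=> m; left.
  - by move=> x y m _ ->.
  - by move=> x y ->.
apply: (@LGw_simulation (GLZ 3) (SL int 3) bool false negb
  (fun s m => s (+) (\det m == -1)) (fun m => \det m *: m)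
  (fun s x y => \det x = (-1) ^+ s /\ y = \det x *: x)) => /=.
- by move=> m hm; rewrite detZ; case: hm => ->.
- by rewrite det1 scale1r.
- move=> s x y m hm [dx ->]; rewrite det_mulmx dx; split.
    by case: hm => ->; case: s {dx} => //=; rewrite ?eqxx.
  by rewrite -scalemxAl -scalemxAr scalerA.
- move=> s x y [dx ->]; split=> [x1|[]].
    by move: dx; rewrite x1 det1; case: s => //= _; rewrite scale1r.
  by case: s dx => //= ->; rewrite scale1r.
Qed.

(** * Fooling sets and word problems *)

(** Cut an accepting run on [u i ++ v i] after [u i], and send [i] to the state reached there
    together with a code of the register. If [i] and [j] have the same image, the first half for [i]
    followed by the second half for [j] accepts [u i ++ v j], so this map is injective. *)
Lemma fooling_bound (G : grp) (Sigma : finType) (L : seq Sigma -> Prop)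
    (A : gaut G Sigma) (c l : nat) (I K : finType) (u v : I -> seq Sigma)
    (code : K -> gcar G -> Prop) :
  (forall w, L w <-> gaccepts G Sigma A w) ->
  (forall w, L w -> exists n, (n <= c * (size w).+1)%N /\ accepts_in G Sigma A w n) ->
  (forall i, L (u i ++ v i)) ->
  (forall i j, L (u i ++ v j) -> i = j) ->
  (forall i, (size (u i ++ v i) <= l)%N) ->
  (forall k x y, code k x -> code k y -> x = y) ->
  (forall w q x n, (n <= c * l.+1)%N -> runs A (gq0 A) (gone G) w q x n ->
     exists k, code k x) ->
  (#|I| <= #|gQT A| * #|K|)%N.
Proof.
move=> recL timeL Luv foolL sizeL codeI codeE.
have /fin_all_exists[f fP] : forall i, exists qk : gQT A * K, exists x n1,
    [/\ runs A (gq0 A) (gone G) (u i) qk.1 x n1, code qk.2 x &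
      exists qf y n2, [/\ runs A qk.1 x (v i) qf y n2, gacc A qf & geq G y (gone G)]].
  move=> i; have [n [nb [qf [y [r [acc y1]]]]]] := timeL _ (Luv i).
  have [q1 [x1 [n1 [n2 [r1 r2 En]]]]] := runs_split r.
  have [|k kx] := codeE _ _ _ _ _ r1.
    apply: leq_trans (leq_trans (leq_addr n2 n1) _) (leq_trans nb _); first by rewrite En.
    by rewrite leq_mul2l ltnS sizeL orbT.
  by exists (q1, k), x1, n1; split=> //; exists qf, y, n2.
rewrite -card_prod; apply: (leq_card f) => i j eq_f; apply: foolL.
have [x [n1 [r1 cx _]]] := fP i; have [x' [n1' [_ cx' [qf [y [n2 [r2 acc y1]]]]]]] := fP j.
rewrite -eq_f in cx' r2; rewrite -(codeI _ _ _ cx cx') in r2.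
apply/recL; exists (n1 + n2)%N, qf, y; split=> //; exact: runs_cat r1 r2.
Qed.

Record congruent (G : grp) : Prop := Congruent {
  geq_refl : forall x, geq G x x;
  geq_sym : forall x y, geq G x y -> geq G y x;
  geq_trans : forall x y z, geq G x y -> geq G y z -> geq G x z;
  geq_mulr : forall x y m, geq G x y -> geq G (gmul G x m) (gmul G y m) }.

Section WordProblem.
Variables (G : grp) (Sigma : finType) (p : Sigma -> gcar G).

Definition wprod (x : gcar G) (w : seq Sigma) : gcar G :=
  foldl (fun x a => gmul G x (p a)) x w.

Definition WP (w : seq Sigma) : Prop := geq G (wprod (gone G) w) (gone G).

Hypothesis pmem : forall a, gmem G (p a).

Definition WP_delta (q : unit) (a : option Sigma) : seq (unit * gcar G) :=
  if a is Some a then [:: (tt, p a)] else [::].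

Lemma WP_delta_mem q a q' m : List.In (q', m) (WP_delta q a) -> gmem G m.
Proof. by case: a => [a|] /= [] // [_ <-]. Qed.

Definition WP_aut : gaut G Sigma := GAut G Sigma unit tt predT WP_delta WP_delta_mem.

Lemma WP_runs x w : runs WP_aut tt x w tt (wprod x w) (size w).
Proof.
elim: w x => [|a w IH] x; first exact: run_nil.
by apply: run_sym (IH _); left.
Qed.

Lemma WP_runs_inv q x w q' y n : runs WP_aut q x w q' y n -> y = wprod x w.
Proof.
elim=> {q x w q' y n} // q x a q1 m w q' y n.
by case=> // -[_ <-] _ ->.
Qed.

Lemma LGw_WP : LGw G Sigma WP.
Proof.
apply/LGwP; exists WP_aut, 1%N; split=> w.
  split=> [ww|[n [[] [y [/WP_runs_inv -> [_]]]]] //].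
  by exists (size w), tt, (wprod (gone G) w); split=> //; apply: WP_runs.
move=> ww; exists (size w); split; first by rewrite mul1n.
by exists tt, (wprod (gone G) w); split=> //; apply: WP_runs.
Qed.

Variable inv : Sigma -> Sigma.
Hypothesis congG : congruent G.
Hypothesis invK : involutive inv.
Hypothesis mulpK : forall x a, geq G (gmul G (gmul G x (p a)) (p (inv a))) x.

Lemma wprod_cat x u v : wprod x (u ++ v) = wprod (wprod x u) v.
Proof. exact: foldl_cat. Qed.

Lemma wprod_cong x y w : geq G x y -> geq G (wprod x w) (wprod y w).
Proof. by elim: w x y => //= a w IH x y /(geq_mulr congG (p a)) /IH. Qed.

Lemma wprodK x u : geq G (wprod (wprod x u) (map inv (rev u))) x.
Proof.
elim/last_ind: u x => [|u a IH] x; first exact: geq_refl.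
rewrite rev_rcons /= -cats1 wprod_cat /=.
apply: (geq_trans congG) (IH x); apply: wprod_cong; exact: mulpK.
Qed.

Lemma WP_inv u : WP (u ++ map inv (rev u)).
Proof. by rewrite /WP wprod_cat; apply: wprodK. Qed.

(** Multiplying on the right by [v] cancels its inverse. Hence words with distinct values, paired
    with their inverses, form a fooling set. *)
Lemma WP_fooling u v : WP (u ++ map inv (rev v)) -> geq G (wprod (gone G) u) (wprod (gone G) v).
Proof.
rewrite /WP wprod_cat => /(wprod_cong v); apply: (geq_trans congG).
apply: (geq_sym congG); have := wprodK (wprod (gone G) u) (map inv (rev v)).
by rewrite -map_rev revK (mapK invK).
Qed.

End WordProblem.

Lemma foldl_perm (T : eqType) (X : Type) (h : X -> T -> X) (s t : seq T) x :
  (forall x a b, h (h x a) b = h (h x b) a) -> perm_eq s t -> foldl h x s = foldl h x t.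
Proof.
move=> hC; elim: s t x => [|a s IH] t x.
  by rewrite perm_sym => /perm_nilP ->.
have hfold r y : foldl h (h y a) r = h (foldl h y r) a.
  by elim: r y => //= b r IHr y; rewrite hC IHr.
move=> st; have ta : a \in t by rewrite -(perm_mem st) mem_head.
case/splitPr: ta st => t1 t2.
rewrite perm_sym -(cat1s a t2) perm_catCA /= perm_cons perm_sym => /(IH _ (h x a)) ->.
by rewrite !foldl_cat /= hfold.
Qed.

Lemma leq_wexp2r d m n : (m <= n)%N -> (m ^ d <= n ^ d)%N.
Proof. by case: d => // d; rewrite leq_exp2r. Qed.

(** The left side bounds the configurations of an automaton with [Q] states and [d] transitions over
    a commutative group on inputs of length [2 * n]; the right side is the size of a fooling set. *)
Lemma expn_gt_poly (Q c d : nat) : exists n, (Q * (c * (2 * n).+1).+1 ^ d < 2 ^ n)%N.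
Proof.
have [m mP] : exists m, (Q + (c + 2) * d + m * d <= 2 ^ m)%N.
  (* With [m = 2 * j] one has [2 ^ m >= (j + 1) ^ 2], and [j >= 2 * d] makes this square exceed the
     linear function of [m]. *)
  exists (2 * (Q + (c + 2) * d + 2 * d))%N; set a := (Q + (c + 2) * d)%N.
  set j := (a + 2 * d)%N; rewrite mul2n -addnn expnD.
  apply: (@leq_trans (j.+1 * j.+1)); last by rewrite leq_mul // ltn_expl.
  rewrite /j; nia.
(* At [n = 2 ^ m] the polynomial is bounded by a power of 2 whose exponent is linear in [m]. *)
exists (2 ^ m)%N.
have le1 : ((c * (2 * 2 ^ m).+1).+1 <= 2 ^ (c + 2 + m))%N.
  rewrite !expnD; have := @ltn_expl 2 c isT; have : (0 < 2 ^ m)%N by rewrite expn_gt0.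
  move: (2 ^ m)%N (2 ^ c)%N => x y; nia.
apply: (@leq_trans (2 ^ Q * (2 ^ (c + 2 + m)) ^ d)).
  apply: (@leq_trans (2 ^ Q * (c * (2 * 2 ^ m).+1).+1 ^ d)).
    by rewrite ltn_pmul2r ?expn_gt0 // ltn_expl.
  by rewrite leq_mul2l leq_wexp2r // orbT.
by rewrite -expnM -expnD leq_exp2l //; lia.
Qed.

(** * Automata over commutative groups *)

Section Commutative.
Variables (G : grp) (Sigma : finType) (A : gaut G Sigma).
Hypothesis mulC : forall x a b, gmul G (gmul G x a) b = gmul G (gmul G x b) a.

(** Uses of a transition are counted by its index in this list, since equality on [gcar G] need not
    be decidable. *)
Definition transitions : seq (gcar G) :=
  [seq p.2 | p <- flatten [seq gdelta A q a | q <- enum (gQT A), a <- enum {: option Sigma}]].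

Definition acc_trans (x : gcar G) (l : seq nat) : gcar G :=
  foldl (fun x i => gmul G x (nth (gone G) transitions i)) x l.

Lemma In_nth_lt (T : Type) (x0 x : T) (s : seq T) : List.In x s ->
  exists2 i, (i < size s)%N & nth x0 s i = x.
Proof.
elim: s => //= y s IH [->|/IH[i]]; first by exists 0%N.
by exists i.+1.
Qed.

Lemma In_flatten (T : Type) (ss : seq (seq T)) s x : List.In s ss -> List.In x s ->
  List.In x (flatten ss).
Proof.
by elim: ss => //= s1 ss IH [->|/IH h] xs; apply: List.in_or_app; [left|right; apply: h].
Qed.

Lemma mem_In (T : eqType) (x : T) s : x \in s <-> List.In x s.
Proof.
by elim: s => //= y s IH; rewrite inE -IH; split=> [/predU1P[]|[]] ->; rewrite ?eqxx ?orbT; auto.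
Qed.

Lemma transitionsP q a q1 m : List.In (q1, m) (gdelta A q a) ->
  exists2 i, (i < size transitions)%N & nth (gone G) transitions i = m.
Proof.
move=> hin; apply: In_nth_lt; apply/List.in_map_iff; exists (q1, m); split=> //.
apply: In_flatten hin; rewrite /allpairs.
elim: (enum _) (mem_enum predT q) => //= q0 s IH.
rewrite inE => /predU1P[<-|/IH h]; apply: List.in_or_app; last by right.
by left; apply: List.in_map; apply/mem_In; rewrite mem_enum.
Qed.

Lemma runs_trace q x w q' y n : runs A q x w q' y n -> exists l,
  [/\ size l = n, all (fun i => i < size transitions)%N l & y = acc_trans x l].
Proof.
elim=> {q x w q' y n} [q x|q x q1 m w q' y n hin _|q x a q1 m w q' y n hin _].
- by exists [::].
- have [i li <-] := transitionsP hin; case=> l [<- al ->].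
  by exists (i :: l); split=> //=; rewrite li.
- have [i li <-] := transitionsP hin; case=> l [<- al ->].
  by exists (i :: l); split=> //=; rewrite li.
Qed.

Lemma not_LGw_comm_aux (c : nat) (L : seq Sigma -> Prop) :
  (forall w, L w <-> gaccepts G Sigma A w) ->
  (forall w, L w -> exists n, (n <= c * (size w).+1)%N /\ accepts_in G Sigma A w n) ->
  (forall n, exists u v : n.-tuple bool -> seq Sigma,
     [/\ forall i, L (u i ++ v i), forall i j, L (u i ++ v j) -> i = j
       & forall i, (size (u i ++ v i) <= 2 * n)%N]) -> False.
Proof.
move=> recL timeL foolL; set d := size transitions.
have [n] := expn_gt_poly #|gQT A| c d; have [u [v [Luv fuv suv]]] := foolL n.
set T := (c * (2 * n).+1)%N; apply/negP; rewrite -leqNgt.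
pose K := {ffun 'I_d -> 'I_T.+1}.
pose code (k : K) (x : gcar G) := exists l,
  [/\ all (fun i => i < d)%N l, (forall i : 'I_d, count_mem (i : nat) l = k i)
    & x = acc_trans (gone G) l].
have := @fooling_bound G Sigma L A c (2 * n)%N (n.-tuple bool) K u v code recL timeL Luv fuv suv.
rewrite card_tuple card_bool card_ffun !card_ord; apply.
(* Traces with the same count of every index are permutations of each other, so they lead to the
   same register. *)
- move=> k x y [l [al cl ->]] [l' [al' cl' ->]]; apply: foldl_perm => [z a b|].
    exact: mulC.
  apply/allP => i; rewrite mem_cat => ill' /=.
  have id : (i < d)%N by case/orP: ill' => [/(allP al)|/(allP al')].
  by rewrite (cl (Ordinal id)) (cl' (Ordinal id)).
- move=> w q x m mT /runs_trace[l [sl al ->]].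
  have lt (i : 'I_d) : (count_mem (i : nat) l < T.+1)%N.
    by rewrite ltnS (leq_trans (count_size _ _)) // sl.
  by exists [ffun i => Ordinal (lt i)], l; split=> // i; rewrite ffunE.
Qed.

End Commutative.

Lemma not_LGw_comm (G : grp) (Sigma : finType) (L : seq Sigma -> Prop) :
  (forall x a b, gmul G (gmul G x a) b = gmul G (gmul G x b) a) ->
  (forall n, exists u v : n.-tuple bool -> seq Sigma,
     [/\ forall i, L (u i ++ v i), forall i j, L (u i ++ v j) -> i = j
       & forall i, (size (u i ++ v i) <= 2 * n)%N]) ->
  ~ LGw G Sigma L.
Proof.
by move=> mulC foolL /LGwP[A [c [recL timeL]]]; apply: (not_LGw_comm_aux mulC recL timeL foolL).
Qed.

(** * Presentations *)

Section Presentation.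
Variables (X : Type) (Rel : seq (seq (X * bool))).
Implicit Types u v w : seq (X * bool).

Lemma peq_refl w : peq X Rel w w. Proof. exact: Relation_Operators.rst_refl. Qed.

Lemma peq_sym v w : peq X Rel v w -> peq X Rel w v.
Proof. exact: Relation_Operators.rst_sym. Qed.

Lemma peq_trans u v w : peq X Rel u v -> peq X Rel v w -> peq X Rel u w.
Proof. exact: Relation_Operators.rst_trans. Qed.

Lemma peq_ctx u v x y : peq X Rel x y -> peq X Rel (u ++ x ++ v) (u ++ y ++ v).
Proof.
elim=> {x y} [x y xy|x|x y _|x y z _ + _].
- apply: Relation_Operators.rst_step; case: xy => {x y}.
  + move=> s t x b; rewrite -!catA !(catA u s); exact: pstep_free.
  + move=> s t r rR; rewrite -!catA !(catA u s); exact: pstep_rel.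
  + move=> s t r rR; rewrite -!catA !(catA u s); exact: pstep_relinv.
- exact: peq_refl.
- exact: peq_sym.
- exact: peq_trans.
Qed.

Lemma peq_catl u x y : peq X Rel x y -> peq X Rel (u ++ x) (u ++ y).
Proof. by move/(peq_ctx u [::]); rewrite !cats0. Qed.

Lemma peq_catr v x y : peq X Rel x y -> peq X Rel (x ++ v) (y ++ v).
Proof. exact: (peq_ctx [::] v). Qed.

Lemma congruent_pres : congruent (pres_grp X Rel).
Proof.
split; [exact: peq_refl|exact: peq_sym|exact: peq_trans|move=> x y m; exact: peq_catr].
Qed.

Lemma linvK : involutive (linv X). Proof. by case=> x b; rewrite /linv /= negbK. Qed.

Lemma peq_cancel l : peq X Rel [:: l; linv X l] [::].
Proof.
apply: peq_sym; apply: Relation_Operators.rst_step; case: l => x b.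
exact: (pstep_free X Rel [::] [::]).
Qed.

Lemma peq_winv w : peq X Rel (w ++ winv X w) [::].
Proof.
elim: w => [|l w IH]; first exact: peq_refl.
rewrite /winv /= rev_cons -cats1 catA -/(winv X w).
by apply: peq_trans (peq_cancel l); apply: (peq_ctx [:: l] [:: linv X l] IH).
Qed.

Lemma peq_mulK x w : peq X Rel ((x ++ w) ++ winv X w) x.
Proof. by rewrite -catA -[X in peq _ _ _ X]cats0; apply: peq_catl; apply: peq_winv. Qed.

Section Action.
Variables (T : Type) (phi : X * bool -> T -> T).
Hypothesis phiK : forall l t, phi l (phi (linv X l) t) = t.

Definition act w t := foldr phi t w.

Hypothesis phiR : forall r, List.In r Rel -> forall t, act r t = t.

Lemma act_cat u v t : act (u ++ v) t = act u (act v t).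
Proof. exact: foldr_cat. Qed.

Lemma act_winv w t : act (winv X w) (act w t) = t.
Proof.
elim: w => //= l w IH; rewrite /winv /= rev_cons -cats1 act_cat /=.
by rewrite -{2}(linvK l) phiK.
Qed.

(** Every elementary step inserts a word that acts as the identity, so an action satisfying the
    relators is an invariant of the class. This is how words are shown to represent different
    elements. *)
Lemma peq_act v w t : peq X Rel v w -> act v t = act w t.
Proof.
move=> vw; elim: vw t => {v w} [v w vw|w|v w _ IH|u v w _ IH1 _ IH2] t //; last by rewrite IH1.
case: vw t => {v w} [u w x b|u w r rR|u w r rR] t; rewrite !act_cat.
- by rewrite /= -[(x, ~~ b)]/(linv X (x, b)) phiK.
- by rewrite (phiR rR).
- by rewrite -{2}(phiR rR (act w t)) act_winv.
Qed.

End Action.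
End Presentation.

(** * Infinite cyclic subgroups of presented groups *)

Section IntegersInPresentation.
Variables (X : Type) (Rel : seq (seq (X * bool))) (x0 : X).

Definition zword (z : int) : seq (X * bool) := nseq `|z|%N (x0, (z < 0)%R).

Definition esum (w : seq (X * bool)) : int := foldr (fun (l : X * bool) z => z + (-1) ^+ l.2) 0 w.

Definition pure (w : seq (X * bool)) := forall l, List.In l w -> l.1 = x0.

Lemma pure_cat u v : pure u -> pure v -> pure (u ++ v).
Proof. by move=> pu pv l /List.in_app_iff[/pu|/pv]. Qed.

Lemma esum_cat u v : esum (u ++ v) = esum u + esum v.
Proof. by elim: u => [|l u IH] /=; rewrite ?add0r // IH addrAC. Qed.

Lemma pure_zword z : pure (zword z).
Proof. by rewrite /zword => l; elim: `|z|%N => //= n IH [<-|/IH]. Qed.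

Lemma esum_zword z : esum (zword z) = z.
Proof.
have E n b : esum (nseq n (x0, b)) = (-1) ^+ b * n%:Z.
  by elim: n => [|n IH]; rewrite ?mulr0 //= IH intS mulrDr mulr1 addrC.
by rewrite /zword E mulz_sign_abs.
Qed.

Lemma peq_cons_zword b z : peq X Rel ((x0, b) :: zword z) (zword (z + (-1) ^+ b)).
Proof.
have canc b' n : peq X Rel ((x0, b') :: nseq n.+1 (x0, ~~ b')) (nseq n (x0, ~~ b')).
  exact: (peq_catr (nseq n (x0, ~~ b')) (peq_cancel Rel (x0, b'))).
case: z => [[|n]|n]; case: b => //=; rewrite ?expr0 ?expr1.
- exact: peq_refl.
- exact: peq_refl.
- have -> : (Posz n.+1 + -1)%R = Posz n by lia.
  exact: (canc true n).
- have -> : (Posz n.+1 + 1)%R = Posz n.+2 by lia.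
  exact: peq_refl.
- have -> : (Negz n + -1)%R = Negz n.+1 by lia.
  exact: peq_refl.
- case: n => [|n]; first exact: (canc false 0%N).
  have -> : (Negz n.+1 + 1)%R = Negz n by lia.
  exact: (canc false n.+1).
Qed.

Lemma peq_zword w : pure w -> peq X Rel w (zword (esum w)).
Proof.
elim: w => [|[x b] w IH] pw; first exact: peq_refl.
have /= -> : x = x0 by apply: (pw (x, b)); left.
apply: (@peq_trans _ _ _ ((x0, b) :: zword (esum w))); last exact: peq_cons_zword.
by apply: (peq_catl [:: (x0, b)]); apply: IH => l lw; apply: pw; right.
Qed.

Variable phi : X * bool -> rat -> rat.
Hypothesis phiK : forall l t, phi l (phi (linv X l) t) = t.
Hypothesis phiR : forall r, List.In r Rel -> forall t, act phi r t = t.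
Hypothesis phi0 : forall b t, phi (x0, b) t = t + (-1) ^+ b.

(** In an action where [x0] is a unit translation, the image of 0 is the exponent sum; hence [x0]
    has infinite order. *)
Lemma peq_nil_esum w : pure w -> peq X Rel w [::] <-> esum w = 0.
Proof.
move=> pw; split=> [w1|z0]; last by have := peq_zword pw; rewrite z0.
have : act phi w 0 = 0 by rewrite (peq_act phiK phiR 0 w1).
have -> : act phi w 0 = (esum w)%:~R.
  elim: w pw {w1} => //= -[x b] w IH pw; rewrite IH; last by move=> l lw; apply: pw; right.
  have /= -> : x = x0 by apply: (pw (x, b)); left.
  by rewrite phi0 intrD rmorphXn.
by move/eqP; rewrite intr_eq0 => /eqP.
Qed.

Lemma LGw_Z_pres : csub (LGw Zgrp) (LGw (pres_grp X Rel)).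
Proof.
apply: (@LGw_hom Zgrp (pres_grp X Rel) zword (fun z w => pure w /\ esum w = z)) => //=.
- by split=> [l|].
- move=> x y m _ [py <-]; rewrite esum_cat esum_zword; split=> //.
  by apply: pure_cat => //; apply: pure_zword.
- by move=> x y [/peq_nil_esum -> ->].
Qed.

End IntegersInPresentation.

(** Without relators any family of bijections is an action; this one shows that [x0] has infinite
    order in a free group. *)
Definition transl (X : eqType) (x0 : X) (l : X * bool) (t : rat) : rat :=
  if l.1 == x0 then t + (-1) ^+ l.2 else t.

Lemma translK (X : eqType) (x0 : X) l t : transl x0 l (transl x0 (linv X l) t) = t.
Proof. by rewrite /transl /=; case: eqP => // _; rewrite signrN subrK. Qed.

Lemma LGw_Z_free r : csub (LGw Zgrp) (LGw (Free r.+1)).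
Proof.
apply: (@LGw_Z_pres _ _ ord0 (transl ord0)) => //; exact: translK.
Qed.

Lemma LGw_Free1_Z : csub (LGw (Free 1)) (LGw Zgrp).
Proof.
have pw (w : seq ('I_1 * bool)) : pure ord0 w by move=> l _; rewrite ord1.
have E := @peq_nil_esum _ _ _ _ (@translK _ (ord0 : 'I_1)) _ _ _ (pw _).
apply: (@LGw_hom (Free 1) Zgrp (@esum _) (fun w z => z = esum w)) => //=.
  by move=> x y m _ ->; rewrite esum_cat.
move=> x y ->; apply: E => //; by move=> b t; rewrite /transl eqxx.
Qed.

(** The affine representation of BS(1,2): conjugating the unit translation by the doubling map gives
    the translation by 2. *)
Definition aff_BS (l : bool * bool) (t : rat) : rat :=
  match l with
  | (false, false) => t + 1 | (false, true) => t - 1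
  | (true, false) => 2 * t | (true, true) => t / 2
  end.

Lemma aff_BSK l t : aff_BS l (aff_BS (linv bool l) t) = t.
Proof. by case: l => [[] []] /=; field. Qed.

Definition relBS : seq (seq (bool * bool)) :=
  [:: [:: (true, false); (false, false); (true, true); (false, true); (false, true)]].

Lemma aff_BSR r : List.In r relBS -> forall t, act aff_BS r t = t.
Proof. by case=> [<- t|[]] /=; field. Qed.

Lemma LGw_Z_BS12 : csub (LGw Zgrp) (LGw BS12).
Proof. by apply: (@LGw_Z_pres _ _ false _ aff_BSK aff_BSR) => -[] t. Qed.

(** * Exponential growth *)

(** The image of 0 under the composite of the maps [4 * t + d], the head being applied last. As base
    4 numerals, these values separate lists of equal length. *)
Fixpoint digits (u : seq bool) : nat := if u is d :: u then (d + 4 * digits u)%N else 0%N.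

Lemma digits_inj u v : size u = size v -> digits u = digits v -> u = v.
Proof.
elim: u v => [|d u IH] [|e v] //= [/IH h] E.
have -> : d = e by case: d e E => [] [] //; lia.
by rewrite h //; case: d e E => [] [] //; lia.
Qed.

(** Multiplication by a positive letter precomposes [rho] with [4 * t] or [4 * t + 1], so the
    [2 ^ n] positive words of length [n] have distinct values and, with their inverses, form a
    fooling set. The base is 4 because diag(2, 1/2) acts on the line as [4 * t]. *)
Lemma exponential_separation (G H : grp) (p : bool * bool -> gcar H)
    (rho : gcar H -> rat -> rat) :
  (forall x a b, gmul G (gmul G x a) b = gmul G (gmul G x b) a) ->
  congruent H -> (forall l, gmem H (p l)) ->
  (forall x l, geq H (gmul H (gmul H x (p l)) (p (linv bool l))) x) ->
  (forall x y t, geq H x y -> rho x t = rho y t) ->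
  (forall t, rho (gone H) t = t) ->
  (forall x d t, rho (gmul H x (p (d, false))) t = rho x (4 * t + (nat_of_bool d)%:R)) ->
  exists (Sigma : finType) (L : seq Sigma -> Prop), LGw H Sigma L /\ ~ LGw G Sigma L.
Proof.
move=> mulC congH pmem mulpK rhoE rho1 rhoM; exists (bool * bool)%type, (WP p).
split; first exact: LGw_WP.
apply: not_LGw_comm => // n.
pose u (i : n.-tuple bool) := [seq (d, false) | d <- i].
exists u, (fun i => map (linv bool) (rev (u i))); split=> [i|i j /WP_fooling h|i].
- by apply: WP_inv.
- have {h} := h congH (@linvK _) mulpK.
  have rhoP (x : gcar H) (w : seq bool) :
      rho (wprod p x [seq (d, false) | d <- w]) 0 = rho x (digits w)%:R.
    elim: w x => //= d w IH x; rewrite IH rhoM; congr (rho x _).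
    by rewrite natrD natrM addrC.
  move=> /(rhoE _ _ 0); rewrite !rhoP !rho1 => /eqP; rewrite eqr_nat => /eqP E.
  by apply: val_inj; apply: digits_inj => //; rewrite !size_tuple.
- by rewrite !(size_cat, size_map, size_rev, size_tuple) addnn mul2n.
Qed.

(** * Two by two matrices and the three exponential separations *)

Section Matrix2.
Variable R : comNzRingType.

Definition mk2 (a b c d : R) : 'M[R]_2 :=
  \matrix_(i, j) (if (i : nat) is 0 then if (j : nat) is 0 then a else b
                  else if (j : nat) is 0 then c else d).

Lemma mk2E (M : 'M[R]_2) : M = mk2 (M 0 0) (M 0 1) (M 1 0) (M 1 1).
Proof.
by apply/matrixP=> -[[|[|//]] hi] [[|[|//]] hj]; rewrite mxE /=; congr (M _ _); apply: val_inj.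
Qed.

Lemma mk2_inj a b c d a' b' c' d' : mk2 a b c d = mk2 a' b' c' d' ->
  [/\ a = a', b = b', c = c' & d = d'].
Proof.
move=> /matrixP E.
by split; [have := E 0 0|have := E 0 1|have := E 1 0|have := E 1 1]; rewrite !mxE.
Qed.

Lemma mul_mk2 a b c d a' b' c' d' : mk2 a b c d *m mk2 a' b' c' d' =
  mk2 (a * a' + b * c') (a * b' + b * d') (c * a' + d * c') (c * b' + d * d').
Proof.
by apply/matrixP=> -[[|[|//]] hi] [[|[|//]] hj]; rewrite !mxE !big_ord_recl big_ord0 !mxE /= addr0.
Qed.

Lemma mk2_1 : 1%:M = mk2 1 0 0 1.
Proof. by apply/matrixP=> -[[|[|//]] hi] [[|[|//]] hj]; rewrite !mxE. Qed.

Lemma det_mk2 a b c d : \det (mk2 a b c d) = a * d - b * c.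
Proof.
rewrite (expand_det_row _ ord0) !big_ord_recl big_ord0 /cofactor !det_mx11 !mxE /=.
by rewrite expr0 expr1; ring.
Qed.

End Matrix2.

Lemma congruent_mat (R : comNzRingType) n P : congruent (@mat_grp R n P).
Proof. by split=> //= [x y z -> -> //|x y m ->]. Qed.

(** Upper triangular matrices of determinant 1 whose Moebius maps are [4 * t] and [4 * t + 1], with
    their inverses. *)
Definition SL2Q_letter (l : bool * bool) : 'M[rat]_2 :=
  match l with
  | (false, false) => mk2 2 0 0 (1/2) | (false, true) => mk2 (1/2) 0 0 2
  | (true, false) => mk2 2 (1/2) 0 (1/2) | (true, true) => mk2 (1/2) (-1/2) 0 2
  end.

Lemma cstrict_Qplus_SL2Q : cstrict (LGw Qplus) (LGw (SL rat 2)).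
Proof.
split.
  apply: (@LGw_hom Qplus (SL rat 2) (fun x => mk2 x 0 0 x^-1)
    (fun x M => 0 < x /\ M = mk2 x 0 0 x^-1)) => /=.
  - by move=> m m0; rewrite det_mk2 mulr0 subr0 divff // gt_eqF.
  - by rewrite invr1 -mk2_1.
  - move=> x M m m0 [x0 ->]; rewrite mulr_gt0 //; split=> //.
    by rewrite mul_mk2 !(mulr0, mul0r, addr0, add0r) invfM.
  - move=> x M [x0 ->]; rewrite mk2_1; split=> [->|/mk2_inj[]//]; by rewrite invr1.
(* On upper triangular matrices of determinant 1 this formula is the Moebius action. It reads only
   the first row, and its behaviour under positive letters is an identity in that row, valid for
   every [x]. *)
apply: (@exponential_separation Qplus (SL rat 2) SL2Q_letter
  (fun M t => M 0 0 ^+ 2 * t + M 0 0 * M 0 1)) => /=.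
- by move=> x a b; rewrite mulrAC.
- exact: congruent_mat.
- by case=> [[] []] /=; rewrite det_mk2; field.
- move=> x l; rewrite -mulmxA; case: l => [[] []] /=; rewrite mul_mk2;
    rewrite -[RHS]mulmx1 mk2_1; congr (_ *m mk2 _ _ _ _); by field.
- by move=> x y t ->.
- by move=> t; rewrite !mxE /=; ring.
- by move=> x d t; rewrite (mk2E x); case: d => /=; rewrite mul_mk2 !mxE /=; field.
Qed.

(** The words [b ^ 2] and [a b ^ 2] act as [4 * t] and [4 * t + 1]. *)
Definition BS12_letter (l : bool * bool) : seq (bool * bool) :=
  let w := (if l.1 then [:: (false, false)] else [::]) ++ [:: (true, false); (true, false)] in
  if l.2 then winv bool w else w.

Lemma cstrict_Z_BS12 : cstrict (LGw Zgrp) (LGw BS12).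
Proof.
split; first exact: LGw_Z_BS12.
apply: (@exponential_separation Zgrp BS12 BS12_letter (act aff_BS)) => //=.
- by move=> x a b; rewrite addrAC.
- exact: congruent_pres.
- move=> x [d b]; have -> : BS12_letter (linv bool (d, b)) = winv bool (BS12_letter (d, b)).
    by case: d b => [] [].
  exact: peq_mulK.
- by move=> x y t; apply: (peq_act aff_BSK aff_BSR).
- by move=> x d t; rewrite act_cat; congr (act _ x _); case: d => /=; ring.
Qed.

Definition aff_free (l : 'I_2 * bool) (t : rat) : rat :=
  let d := (l.1 : nat)%:R in if l.2 then (t - d) / 4 else 4 * t + d.

Lemma aff_freeK l t : aff_free l (aff_free (linv 'I_2 l) t) = t.
Proof. by case: l => x []; rewrite /aff_free /=; field. Qed.

Lemma cstrict_Z_Free2 : cstrict (LGw Zgrp) (LGw (Free 2)).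
Proof.
split; first exact: LGw_Z_free.
apply: (@exponential_separation Zgrp (Free 2)
  (fun l => [:: (if l.1 then ord_max else ord0 : 'I_2, l.2)]) (act aff_free)) => //=.
- by move=> x a b; rewrite addrAC.
- exact: congruent_pres.
- by move=> x [d b]; apply: peq_mulK.
- by move=> x y t; apply: (peq_act aff_freeK).
- by move=> x d t; rewrite act_cat; congr (act _ x _); case: d => /=; rewrite /aff_free /=; ring.
Qed.

(** * The Heisenberg group *)

(** Heisenberg coordinates: [a] and [b] on the superdiagonal, [c] in the central corner. *)
Definition hm (a b c : int) : 'M[int]_3 :=
  \matrix_(i, j) (match (i : nat), (j : nat) with
    | 0%N, 0%N => 1 | 0%N, 1%N => a | 0%N, _ => c
    | 1%N, 0%N => 0 | 1%N, 1%N => 1 | 1%N, _ => b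
    | _, 0%N => 0 | _, 1%N => 0 | _, _ => 1 end).

Lemma mul_hm a b c a' b' c' :
  hm a b c *m hm a' b' c' = hm (a + a') (b + b') (c + c' + a * b').
Proof.
apply/matrixP=> -[[|[|[|//]]] hi] [[|[|[|//]]] hj]; rewrite !mxE !big_ord_recl big_ord0 !mxE /=; ring.
Qed.

Lemma hm_1 : 1%:M = hm 0 0 0.
Proof. by apply/matrixP=> -[[|[|[|//]]] hi] [[|[|[|//]]] hj]; rewrite !mxE. Qed.

Lemma hm_inj a b c a' b' c' : hm a b c = hm a' b' c' -> [/\ a = a', b = b' & c = c'].
Proof.
by move=> /matrixP E; split; [have := E 0 1|have := E 1 (1 + 1)|have := E 0 (1 + 1)]; rewrite !mxE.
Qed.

Lemma hm_mem a b c : gmem Heis (hm a b c).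
Proof.
by split=> [[[|[|[|//]]] hi]|[[|[|[|//]]] hi] [[|[|[|//]]] hj]]; rewrite mxE.
Qed.

(** The matrices with [a = 0] form a copy of Z^2, as the twisting term [a * b'] of the product
    vanishes on them. *)
Lemma LGw_Zk2_Heis : csub (LGw (Zk 2)) (LGw Heis).
Proof.
apply: (@LGw_hom (Zk 2) Heis (fun v => hm 0 (v 0 0) (v 0 1))
  (fun v M => M = hm 0 (v 0 0) (v 0 1))) => /=.
- by move=> m _; apply: hm_mem.
- by rewrite hm_1 !mxE.
- by move=> v M m _ ->; rewrite mul_hm !mxE mul0r !addr0.
- move=> v M ->; rewrite hm_1; split=> [->|/hm_inj[_ v0 v1]]; first by rewrite !mxE.
  apply/rowP=> j; rewrite mxE; case: j => [[|[|//]] hj].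
    by rewrite -v0; congr (v _ _); apply: val_inj.
  by rewrite -v1; congr (v _ _); apply: val_inj.
Qed.

Lemma LGw_Heis_SL3 : csub (LGw Heis) (LGw (SL int 3)).
Proof.
apply: (@LGw_hom Heis (SL int 3) id eq) => //= [M [M1 M0]|x y m _ ->|x y ->] //.
rewrite -det_tr det_trig; first by apply: big1 => i _; rewrite mxE M1.
by apply/is_trig_mxP => i j ij; rewrite mxE M0.
Qed.

Lemma LGw_SL2_SL3 (R : comNzRingType) : csub (LGw (SL R 2)) (LGw (SL R 3)).
Proof.
apply: (@LGw_hom (SL R 2) (SL R 3) (fun M => block_mx M 0 0 (1%:M : 'M_1) : 'M_(2 + 1))
  (fun M N => N = block_mx M 0 0 (1%:M : 'M_1) :> 'M_(2 + 1))) => /=.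
- by move=> m m1; rewrite [LHS](det_ublock (m : 'M_2) 0 1%:M) m1 det1 mulr1.
- exact: (scalar_mx_block 2 1).
- move=> M N m _ ->; rewrite [LHS](mulmx_block (M : 'M_2) 0 0 1%:M (m : 'M_2)).
  by rewrite !(mulmx0, mul0mx, addr0, add0r) mulmx1.
- move=> M N ->; rewrite [X in _ <-> _ = X](scalar_mx_block 2 1).
  by split=> [->|E] //; have [->] := eq_block_mx (E : _ = _ :> 'M_(2 + 1)).
Qed.

Lemma LGw_Zk2_Zk k : (2 <= k)%N -> csub (LGw (Zk 2)) (LGw (Zk k)).
Proof.
case: k => [|[|k]] // _.
pose f (v : 'rV[int]_2) : 'rV[int]_k.+2 := row_mx v (0 : 'rV_k).
apply: (@LGw_hom (Zk 2) (Zk k.+2) f (fun v x => x = f v)) => //=.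
- by rewrite [RHS]row_mx0.
- move=> x y m _ ->; rewrite [LHS](add_row_mx (x : 'rV_2) (0 : 'rV_k) (m : 'rV_2) 0).
  by rewrite addr0.
- move=> x y ->; have f0 : f 0 = 0 by exact: (@row_mx0 _ 1 2 k).
  by split=> [->|] //; rewrite -f0 => /(@eq_row_mx _ 1 2 k)[].
Qed.

(** Here [M] is the largest absolute value of an entry of a transition, so that one step moves each
    coordinate by at most [M]. *)
Lemma runs_Zk_bound k (Sigma : finType) (A : gaut (Zk k) Sigma) : exists M : nat,
  forall q x w q' y n, runs A q x w q' y n -> forall j, (`|y 0%R j| <= `|x 0%R j| + M * n)%N.
Proof.
pose s : seq 'rV[int]_k := transitions A.
exists (\max_(i < size s) \max_(j < k) `|(nth 0%R s i : 'rV[int]_k) 0%R j|)%N.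
set M := bigop _ _ _; have MP (i : nat) (j : 'I_k) : (i < size s)%N ->
    (`|(nth 0%R s i : 'rV[int]_k) 0%R j| <= M)%N.
  move=> hi; apply: leq_trans (leq_bigmax (F := fun i : 'I_(size s) => \max_(j < k) _)%N (Ordinal hi)).
  exact: (leq_bigmax (F := fun j => `|(nth 0%R s i : 'rV[int]_k) 0%R j|%N)).
move=> q x w q' y n.
elim=> {q x w q' y n} [q x j|q x q1 m w q' y n hin _ IH j|q x a q1 m w q' y n hin _ IH j].
- by rewrite muln0 addn0.
- have [i hi Em] := transitionsP hin; have := MP i j hi; rewrite [nth _ _ _]Em => Mm.
  apply: leq_trans (IH j) _; rewrite /= mxE; move: Mm.
  by move: ((m : 'rV[int]_k) 0%R j) ((x : 'rV[int]_k) 0%R j) => ma mb; lia.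
- have [i hi Em] := transitionsP hin; have := MP i j hi; rewrite [nth _ _ _]Em => Mm.
  apply: leq_trans (IH j) _; rewrite /= mxE; move: Mm.
  by move: ((m : 'rV[int]_k) 0%R j) ((x : 'rV[int]_k) 0%R j) => ma mb; lia.
Qed.

Definition Heis_letter (l : option bool * bool) : 'M[int]_3 :=
  let e := (-1) ^+ l.2 in
  match l.1 with
  | Some false => hm e 0 0 | Some true => hm 0 e 0 | None => hm 0 0 e
  end.

Lemma cstrict_Zk2_Heis : cstrict (LGw (Zk 2)) (LGw Heis).
Proof.
split; first exact: LGw_Zk2_Heis.
exists (option bool * bool)%type, (WP (G := Heis) Heis_letter); split.
  by apply: LGw_WP => -[[[]|] b]; apply: hm_mem.
case/LGwP=> A [c [recL timeL]]; have [M MP] := runs_Zk_bound A.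
(* Words of length at most [6 * n] allow [c * (6 * n + 1)] steps, which keeps the coordinates within
   [B]. As [6 * n + 1 <= 7 * n], each takes at most [n * D] values, and [n > Q * D ^ 2] yields
   [Q * (n * D) ^ 2 < n ^ 3]. *)
pose D := (14 * (M * c) + 1)%N; pose Q := #|gQT A|; pose n := (Q * D ^ 2).+1.
pose B := (M * (c * (6 * n).+1))%N.
(* The products x^i y^j z^k are distinct: the superdiagonal gives [i] and [j], and then the corner
   gives [k]. *)
pose u (i : 'I_n * ('I_n * 'I_n)) : seq (option bool * bool) :=
  nseq i.1 (Some false, false) ++ nseq i.2.1 (Some true, false) ++ nseq i.2.2 (None, false).
have uE i : wprod (G := Heis) Heis_letter (gone Heis) (u i) =
    hm i.1%:Z i.2.1%:Z (i.2.2%:Z + i.1%:Z * i.2.1%:Z).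
  have step l w a b d : wprod (G := Heis) Heis_letter (hm a b d) (l :: w) =
    wprod (G := Heis) Heis_letter (hm a b d *m Heis_letter l) w by [].
  have ns m (l : option bool * bool) : nseq m.+1 l = l :: nseq m l by [].
  have X a b d m : wprod (G := Heis) Heis_letter (hm a b d) (nseq m (Some false, false))
      = hm (a + m%:Z) b d.
    elim: m a => [|m IH] a; first by rewrite addr0.
    rewrite ns step [Heis_letter _]/(hm 1 0 0) mul_hm !(mulr0, addr0) IH; congr hm; lia.
  have Y a b d m : wprod (G := Heis) Heis_letter (hm a b d) (nseq m (Some true, false))
      = hm a (b + m%:Z) (d + a * m%:Z).
    elim: m b d => [|m IH] b d; first by rewrite mulr0 !addr0.
    by rewrite ns step [Heis_letter _]/(hm 0 1 0) mul_hm !(mulr0, addr0) IH; congr hm; rewrite ?intS; ring.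
  have Z a b d m : wprod (G := Heis) Heis_letter (hm a b d) (nseq m (None, false))
      = hm a b (d + m%:Z).
    elim: m d => [|m IH] d; first by rewrite addr0.
    rewrite ns step [Heis_letter _]/(hm 0 0 1) mul_hm !(mulr0, addr0) IH; congr hm; lia.
  by rewrite /u !wprod_cat [gone _]hm_1 X Y Z; congr hm; ring.
(* A coordinate between [- B] and [B] becomes an ordinal after a shift by [B]. *)
pose code (k : 'I_(2 * B).+1 * 'I_(2 * B).+1) (x : 'rV[int]_2) :=
  x 0 0 = k.1%:Z - B%:Z /\ x 0 1 = k.2%:Z - B%:Z.
have mulK (x : gcar Heis) l : geq Heis
    (gmul Heis (gmul Heis x (Heis_letter l)) (Heis_letter (linv (option bool) l))) x.
  rewrite /= -mulmxA; case: l => [[[]|] b]; rewrite /Heis_letter /= mul_hm -[RHS]mulmx1 hm_1 signrN;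
    congr (_ *m hm _ _ _); ring.
have := @fooling_bound (Zk 2) _ _ A c (6 * n)%N _ _ u (fun i => map (linv (option bool)) (rev (u i)))
  code recL timeL.
rewrite !card_prod !card_ord; have -> : (#|gQT A| = Q)%N by [].
suff lt : (Q * ((2 * B).+1 * (2 * B).+1) < n * (n * n))%N.
  move=> h; suff /(leq_trans lt) : (n * (n * n) <= Q * ((2 * B).+1 * (2 * B).+1))%N by rewrite ltnn.
  apply: h => {lt}.
  - by move=> i; apply: WP_inv mulK _; apply: congruent_mat.
  - move=> i j /WP_fooling h; have {h} := h (congruent_mat _) (@linvK _) mulK.
    rewrite !uE => /= /hm_inj[E1 E2 E3]; case: i j E1 E2 E3 => [i1 [i2 i3]] [j1 [j2 j3]] /=.
    case=> /val_inj -> [/val_inj ->] E; congr (_, (_, _)); apply: val_inj => /=; lia.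
  - move=> i; rewrite !(size_cat, size_map, size_rev, size_nseq).
    by case: i => [i1 [i2 i3]] /=; have := ltn_ord i1; have := ltn_ord i2; have := ltn_ord i3; lia.
  - move=> k x y [x0 x1] [y0 y1]; apply/rowP=> -[[|[|//]] hj].
      by rewrite (_ : Ordinal hj = 0) ?x0 ?y0 //; apply: val_inj.
    by rewrite (_ : Ordinal hj = 1) ?x1 ?y1 //; apply: val_inj.
  - move=> w q x m mT /MP bnd.
    have {}bnd j : (`|x 0%R j| <= B)%N.
      by have := bnd j; rewrite mxE absz0 add0n => /leq_trans; apply; rewrite leq_mul2l mT orbT.
    have lt j : (`|(x 0 j + B%:Z)%R| < (2 * B).+1)%N.
      by have := bnd j; move: (x 0 j) => z; lia.
    exists (Ordinal (lt 0), Ordinal (lt 1)); split=> /=.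
      by have := bnd 0; move: (x 0 0) => z; lia.
    by have := bnd 1; move: (x 0 1) => z; lia.
have BD : ((2 * B).+1 <= n * D)%N.
  by rewrite /B /D; move: (M * c)%N (mulnA M c (6 * n).+1) => e ->; rewrite /n; nia.
apply: (@leq_ltn_trans (Q * ((n * D) * (n * D)))); first by rewrite leq_mul2l leq_mul ?orbT.
have -> : (Q * ((n * D) * (n * D)) = (n * n) * (Q * D ^ 2))%N by rewrite expnS expn1; nia.
by rewrite (mulnA n n n) ltn_pmul2l // ltnS.
Qed.

(** * Pumping *)

(** The context-free pumping property, stated without a length bound on [v ++ x ++ y]. *)
Definition pumpable (Sigma : Type) (L : seq Sigma -> Prop) : Prop :=
  exists N, forall w, L w -> (N < size w)%N -> exists u v x y z,
    [/\ w = u ++ v ++ x ++ y ++ z, (0 < size (v ++ y))%N &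
     forall k, L (u ++ flatten (nseq k v) ++ x ++ flatten (nseq k y) ++ z)].

Section BinaryGrammar.
Variables (I : eqType) (Sigma : Type).
Variables (leaf : I -> seq Sigma -> Prop) (rule : I -> I -> I -> Prop).

(** Common form of context-free derivations and of runs over SL(2,Z): a leaf yields at most one
    letter, and only the finitely many labels in [Is] branch. *)
Inductive btree : I -> seq Sigma -> Prop :=
| bt_leaf i w : leaf i w -> btree i w
| bt_rule i j k u v : rule i j k -> btree j u -> btree k v -> btree i (u ++ v).

(** A derivation from [i] with a hole labelled [j], represented by its effect on the words that fill
    the hole. *)
Definition ctx i j u z := forall x, btree j x -> btree i (u ++ x ++ z).

Lemma ctx_refl i : ctx i i [::] [::]. Proof. by move=> x; rewrite cats0. Qed.

Lemma ctx_left i j k l u z v : rule i j k -> btree k v -> ctx j l u z -> ctx i l u (z ++ v).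
Proof. by move=> r tv c x /c tx; rewrite !catA -(catA u); apply: bt_rule r tx tv. Qed.

Lemma ctx_right i j k l u z v : rule i j k -> btree j v -> ctx k l u z -> ctx i l (v ++ u) z.
Proof. by move=> r tv c x /c tx; rewrite -catA; apply: bt_rule r tv tx. Qed.

Definition has_node i w j :=
  exists u x z, [/\ w = u ++ x ++ z, ctx i j u z & btree j x].

Definition has_pump i w := exists j u v x y z,
  [/\ w = u ++ v ++ x ++ y ++ z, (0 < size (v ++ y))%N, ctx i j u z, ctx j j v y & btree j x].

Lemma has_node_left i j k l u v : rule i j k -> btree k v ->
  has_node j u l -> has_node i (u ++ v) l.
Proof.
move=> r tv [s [x [z [-> c tx]]]]; exists s, x, (z ++ v); split=> //.
  by rewrite -!catA.
exact: ctx_left r tv c.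
Qed.

Lemma has_node_right i j k l u v : rule i j k -> btree j u ->
  has_node k v l -> has_node i (u ++ v) l.
Proof.
move=> r tu [s [x [z [-> c tx]]]]; exists (u ++ s), x, z; split=> //.
  by rewrite -!catA.
exact: ctx_right r tu c.
Qed.

Lemma has_pump_left i j k u v : rule i j k -> btree k v -> has_pump j u -> has_pump i (u ++ v).
Proof.
move=> r tv [l [s [v1 [x [y [z [-> sz c1 c2 tx]]]]]]].
exists l, s, v1, x, y, (z ++ v); split=> //; first by rewrite -!catA.
exact: ctx_left r tv c1.
Qed.

Lemma has_pump_right i j k u v : rule i j k -> btree j u -> has_pump k v -> has_pump i (u ++ v).
Proof.
move=> r tu [l [s [v1 [x [y [z [-> sz c1 c2 tx]]]]]]].
exists l, (u ++ s), v1, x, y, z; split=> //; first by rewrite -!catA.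
exact: ctx_right r tu c1.
Qed.

(** The root label recurs in the left subtree, and the word of the right subtree makes the loop
    nonempty. *)
Lemma has_pump_loop_left i j k u v : rule i j k -> btree k v -> (0 < size v)%N ->
  has_node j u i -> has_pump i (u ++ v).
Proof.
move=> r tv sv [s [x [z [-> c tx]]]]; exists i, [::], s, x, (z ++ v), [::]; split=> //.
- by rewrite /= cats0 -!catA.
- by rewrite !size_cat; lia.
- exact: ctx_refl.
- exact: ctx_left r tv c.
Qed.

Lemma has_pump_loop_right i j k u v : rule i j k -> btree j u -> (0 < size u)%N ->
  has_node k v i -> has_pump i (u ++ v).
Proof.
move=> r tu su [s [x [z [-> c tx]]]]; exists i, [::], (u ++ s), x, z, [::]; split=> //.
- by rewrite /= cats0 -!catA.
- by rewrite !size_cat; lia.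
- exact: ctx_refl.
- exact: ctx_right r tu c.
Qed.

Variable Is : seq I.
Hypothesis leaf_size : forall i w, leaf i w -> (size w <= 1)%N.
Hypothesis rule_root : forall i j k, rule i j k -> i \in Is.

(* The labels in [F] are those of the branching ancestors of the current node:
   meeting one of them again closes a nonempty loop. *)
Lemma btree_trichotomy i w : btree i w -> forall F, uniq F -> {subset F <= Is} ->
  [\/ exists2 l, l \in F & has_node i w l, has_pump i w
    | (size w <= 2 ^ (size Is - size F))%N].
Proof.
elim=> {i w} [i w lw F _ _|i j k u v r tu IHu tv IHv F uF sF].
  by apply: Or33; apply: leq_trans (leaf_size lw) _; rewrite expn_gt0.
have [iF|iF] := boolP (i \in F).
  apply: Or31; exists i => //; exists [::], (u ++ v), [::]; split.
  - by rewrite cats0.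
  - exact: ctx_refl.
  - exact: bt_rule r tu tv.
(* A node with an empty child does not count as branching, and [F] is passed on unchanged to the
   other child. *)
have [/size0nil u0|su] := posnP (size u).
  case: (IHv F uF sF) => [[l lF nl]|pv|]; last by rewrite u0; apply: Or33.
    by apply: Or31; exists l => //; apply: has_node_right r tu nl.
  by apply: Or32; apply: has_pump_right r tu pv.
have [/size0nil v0|sv] := posnP (size v).
  case: (IHu F uF sF) => [[l lF nl]|pu|]; last by rewrite v0 cats0; apply: Or33.
    by apply: Or31; exists l => //; apply: has_node_left r tv nl.
  by apply: Or32; apply: has_pump_left r tv pu.
have uF' : uniq (i :: F) by rewrite /= iF.
have sF' : {subset i :: F <= Is}.
  by move=> l; rewrite inE => /predU1P[->|/sF //]; apply: rule_root r.
have sz : (size F < size Is)%N by apply: (uniq_leq_size uF' sF').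
case: (IHu _ uF' sF') => [[l]|pu|su'].
- rewrite inE => /predU1P[->|lF] nl.
    by apply: Or32; apply: has_pump_loop_left r tv sv nl.
  by apply: Or31; exists l => //; apply: has_node_left r tv nl.
- by apply: Or32; apply: has_pump_left r tv pu.
case: (IHv _ uF' sF') => [[l]|pv|sv'].
- rewrite inE => /predU1P[->|lF] nl.
    by apply: Or32; apply: has_pump_loop_right r tu su nl.
  by apply: Or31; exists l => //; apply: has_node_right r tu nl.
- by apply: Or32; apply: has_pump_right r tu pv.
(* Adding [i] to [F] halved the bound for each child. *)
apply: Or33; rewrite size_cat -(subnSK sz) expnS mul2n -addnn; exact: leq_add.
Qed.

Lemma pumpable_btree (S : I -> Prop) : pumpable (fun w => exists2 i, S i & btree i w).
Proof.
exists (2 ^ size Is)%N => w [i Si tw] sw.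
have sub0 : {subset [::] <= Is} by [].
case: (btree_trichotomy tw (erefl : uniq [::]) sub0) => [[l] //||]; last first.
  by rewrite subn0 leqNgt sw.
case=> j [u [v [x [y [z [-> sz c1 c2 tx]]]]]].
exists u, v, x, y, z; split=> // k; exists i => //.
have {}tx : btree j (flatten (nseq k v) ++ x ++ flatten (nseq k y)).
  elim: k => [|k IH]; first by rewrite /= cats0.
  have -> : flatten (nseq k.+1 y) = flatten (nseq k y) ++ y.
    by rewrite -addn1 nseqD flatten_cat /= cats0.
  by have := c2 _ IH; rewrite /= -!catA.
by have := c1 _ tx; rewrite -!catA.
Qed.

End BinaryGrammar.

Lemma pumpable_ext (Sigma : Type) (L L' : seq Sigma -> Prop) :
  (forall w, L w <-> L' w) -> pumpable L -> pumpable L'.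
Proof.
move=> E [N NP]; exists N => w /E Lw sw; have [u [v [x [y [z [-> sz h]]]]]] := NP w Lw sw.
by exists u, v, x, y, z; split=> // k; apply/E.
Qed.

(** * Context-free grammars as binary grammars *)

Section ContextFree.
Variables (N Sigma : finType) (S : N) (P : seq (N * seq (N + Sigma))).

Lemma derives_cat s t u v : derives N Sigma P s u -> derives N Sigma P t v ->
  derives N Sigma P (s ++ t) (u ++ v).
Proof.
move=> + dt; elim=> {s u} //= [a s w _ IH|X rhs s u w XP dr _ _ IH].
  exact: der_term.
by rewrite -catA; apply: der_nt XP dr IH.
Qed.

Definition suffixes (T : Type) (r : seq T) := [seq drop n r | n <- iota 0 (size r).+1].

(** The branching labels: forms are expanded from the left, so what remains of one is always a
    suffix of a right-hand side or of the start form. *)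
Definition cf_forms : seq (seq (N + Sigma)) :=
  flatten [seq suffixes r | r <- [:: inl S] :: map snd P].

Lemma cf_formsP r s n : r \in [:: inl S] :: map snd P -> s = drop n r -> s \in cf_forms.
Proof.
move=> rP ->; apply/flatten_mapP; exists r => //.
have -> : drop n r = drop (minn n (size r)) r.
  by rewrite /minn; case: ltnP => // h; rewrite drop_size drop_oversize.
by apply/mapP; exists (minn n (size r)); rewrite // mem_iota /= add0n ltnS geq_minr.
Qed.

Lemma cf_forms_tail x s : x :: s \in cf_forms -> s \in cf_forms.
Proof.
case/flatten_mapP => r rP /mapP[n _ E]; apply: (@cf_formsP r s n.+1) => //.
by rewrite -addn1 addnC -drop_drop -E /= drop0.
Qed.

Lemma cf_forms_rhs X r : List.In (X, r) P -> r \in cf_forms.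
Proof.
move=> XP; apply: (@cf_formsP r r 0%N); rewrite ?drop0 // inE; apply/orP; right.
by apply/mem_In; apply/List.in_map_iff; exists (X, r).
Qed.

Definition cf_leaf (s : seq (N + Sigma)) (w : seq Sigma) :=
  (s = [::] /\ w = [::]) \/ exists2 a, s = [:: inr a] & w = [:: a].

(** A form splits into an expansion [r] of its first symbol and its tail [t]; a terminal expands to
    itself, which is then a leaf. *)
Definition cf_rule (s r t : seq (N + Sigma)) := s \in cf_forms /\
  ((exists2 a, s = inr a :: t & r = [:: inr a]) \/ exists2 X, s = inl X :: t & List.In (X, r) P).

Lemma derivesP s w : s \in cf_forms -> derives N Sigma P s w <-> btree cf_leaf cf_rule s w.
Proof.
move=> sI; split=> [d|].
  elim: d sI => {s w} [|a s w _ IH|X r s u v XP _ IHr _ IHs] sI.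
  - exact: (bt_leaf _ (or_introl (conj erefl erefl))).
  - apply: (@bt_rule _ _ cf_leaf cf_rule _ [:: inr a] s [:: a]).
    + by split=> //; left; exists a.
    + by apply: bt_leaf; right; exists a.
    + by apply: IH; apply: cf_forms_tail sI.
  - apply: bt_rule (IHr (cf_forms_rhs XP)) (IHs (cf_forms_tail sI)).
    by split=> //; right; exists X.
elim=> {s w sI} [s w [[-> ->]|[a -> ->]]|s r t u v [sI] h _ IHu _ IHv].
- exact: der_nil.
- by apply: der_term; apply: der_nil.
- case: h IHu => [[a -> ->] IHu|[X -> XP] IHu]; last exact: der_nt XP IHu IHv.
  exact: (derives_cat IHu IHv).
Qed.

End ContextFree.

Lemma pumpable_CF (Sigma : finType) (L : seq Sigma -> Prop) : CF Sigma L -> pumpable L.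
Proof.
case=> N [S [P LP]]; have SI : [:: inl S] \in cf_forms S P.
  by apply: (@cf_formsP _ _ _ _ [:: inl S] _ 0%N); rewrite ?inE ?eqxx ?drop0.
apply: pumpable_ext (@pumpable_btree _ _ (cf_leaf (Sigma := Sigma)) (cf_rule S P) (cf_forms S P)
  _ _ (eq [:: inl S])) => [w|i w|i j k [] //].
- by rewrite LP (derivesP _ SI); split=> [[_ <-]|h] //; exists [:: inl S].
- by case=> [[_ ->]|[a _ ->]].
Qed.

(** * Two languages that cannot be pumped *)

Definition pow2_lang (w : seq unit) : Prop := exists n, size w = (2 ^ n)%N.

(** With [p = size v + size y], taking [2 * 2 ^ N + 1] copies turns the length [2 ^ N] into
    [2 ^ N * (2 * p + 1)], which has an odd divisor greater than 1. *)
Lemma not_pumpable_pow2 : ~ pumpable pow2_lang.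
Proof.
case=> N NP; have [||u [v [x [y [z [E sz pump]]]]]] := NP (nseq (2 ^ N) tt).
- by exists N; rewrite size_nseq.
- by rewrite size_nseq ltn_expl.
have {E} := congr1 size E; rewrite size_nseq => E.
have [n] := pump (2 * 2 ^ N).+1.
have sf (k : nat) (s : seq unit) : size (flatten (nseq k s)) = (k * size s)%N.
  by rewrite size_flatten /shape map_nseq sumn_nseq mulnC.
rewrite !size_cat !sf; move: E sz; rewrite !size_cat => E sz.
have -> : (size u + ((2 * 2 ^ N).+1 * size v + (size x + ((2 * 2 ^ N).+1 * size y + size z))) =
  2 ^ N * (2 * (size v + size y)).+1)%N by nia.
move=> E2; have : ((2 * (size v + size y)).+1 %| 2 ^ n)%N by rewrite -E2 dvdn_mull.
case/(dvdn_pfactor _ _ (isT : prime 2)) => -[|m] _; first by move: sz; lia.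
by rewrite expnS => /(congr1 odd); rewrite /= !oddM.
Qed.

Definition abc_lang (w : seq 'I_3) : Prop := sorted leq (map val w) /\
  forall a b : 'I_3, count_mem a w = count_mem b w.

Lemma sorted_double_constant (v : seq 'I_3) : sorted leq (map val (v ++ v)) ->
  forall a b, a \in v -> b \in v -> a = b.
Proof.
rewrite sorted_map => sv; have trl : transitive (relpre val leq : rel 'I_3).
  by move=> a b c; apply: leq_trans.
have le a b : a \in v -> b \in v -> (a <= b)%N.
  move: sv; rewrite (sorted_pairwise trl) pairwise_cat => /and3P[/allrelP h _ _]; exact: h.
by move=> a b av bv; apply: val_inj; apply/eqP; rewrite eqn_leq !le.
Qed.

(** Doubling keeps the word sorted, so [v] and [y] each use a single letter. Comparing one copy with
    two, all three letters occur equally often in [v ++ y], hence each occurs in [v] or [y]: three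
    letters in two constant words. *)
Lemma not_pumpable_abc : ~ pumpable abc_lang.
Proof.
case=> N NP; pose w n := nseq n (0 : 'I_3) ++ nseq n 1 ++ nseq n (1 + 1).
have cw n a : count_mem a (w n) = n.
  rewrite /w !count_cat !count_nseq /=; case: a => [[|[|[|//]]] h] /=; lia.
have [|| u [v [x [y [z [E sz pump]]]]]] := NP (w N.+1).
- split=> [|a b]; last by rewrite !cw.
  rewrite /w !map_cat !map_nseq (sorted_pairwise (@leq_trans)) !pairwise_cat.
  have al (n a b : nat) : (a <= b)%N -> all (leq a) (nseq n b).
    by move=> ab; rewrite all_nseq ab orbT.
  have pw n (a : nat) : pairwise leq (nseq n a) by elim: n => //= n ->; rewrite al.
  have ar n m (a b : nat) : (a <= b)%N -> allrel leq (nseq n a) (nseq m b).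
    by move=> ab; elim: n => //= n IH; rewrite /allrel /= al.
  by rewrite !allrel_catr !ar // !pw.
- by rewrite /w !size_cat !size_nseq; lia.
have [_ c1] := pump 1%N; have [s2 c2] := pump 2%N.
move: c1 c2 s2; rewrite /= !cats0 => c1 c2 s2.
have infix_sorted s1 s s3 : sorted leq (map val (s1 ++ s ++ s3)) -> sorted leq (map val (s : seq 'I_3)).
  by rewrite !map_cat !(sorted_pairwise (@leq_trans)) !pairwise_cat => /and3P[_ _ /and3P[]].
have vc := sorted_double_constant (infix_sorted _ _ _ s2).
have /sorted_double_constant yc : sorted leq (map val (y ++ y)).
  by apply: (infix_sorted (u ++ (v ++ v) ++ x) _ z); move: s2; rewrite -!catA.
have eqc a b : (count_mem a v + count_mem a y = count_mem b v + count_mem b y)%N.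
  have := c1 a b; have := c2 a b; rewrite !count_cat.
  move: (count _ u) (count _ v) (count _ x) (count _ y) (count _ z).
  move: (count _ u) (count _ v) (count _ x) (count _ y) (count _ z).
  lia.
have memvy a : (a \in v) || (a \in y).
  have : (0 < size (v ++ y))%N := sz; case E1 : (v ++ y) => [//|b s] _.
  have : (0 < count_mem b v + count_mem b y)%N by rewrite -count_cat E1 /= eqxx.
  by rewrite (eqc b a) addn_gt0 -!has_count !has_pred1.
have ne : [/\ (0 : 'I_3) <> 1, (0 : 'I_3) <> 1 + 1 & (1 : 'I_3) <> 1 + 1] by [].
case: ne => n01 n02 n12.
case/orP: (memvy 0) => m0; case/orP: (memvy 1) => m1; case/orP: (memvy (1 + 1)) => m2;
  first [by case: n01; apply: vc | by case: n02; apply: vc | by case: n12; apply: vc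
       | by case: n01; apply: yc | by case: n02; apply: yc | by case: n12; apply: yc].
Qed.

(** * Particular languages and regular languages *)

(** The contribution of a letter to the two differences of consecutive letter counts, which vanish
    exactly on words with equal counts. *)
Definition abc_vec (a : 'I_3) : 'rV[int]_2 :=
  \row_j ((if j == 0 then (a == 0)%:R - (a == 1)%:R else (a == 1)%:R - (a == 1 + 1)%:R) : int).

(** The state is the last letter read, so that sortedness is checked without the register. *)
Definition abc_delta (q : 'I_3) (a : option 'I_3) : seq ('I_3 * 'rV[int]_2) :=
  if a is Some a then if (q <= a)%N then [:: (a, abc_vec a)] else [::] else [::].

Definition abc_aut : gaut (Zk 2) 'I_3 :=
  GAut (Zk 2) 'I_3 _ ord0 predT abc_delta (fun _ _ _ _ _ => I).

Lemma abc_runs (q : 'I_3) x w : path leq q (map val w) ->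
  exists q', runs abc_aut q x w q' (x + \sum_(a <- w) abc_vec a) (size w).
Proof.
elim: w q x => [|a w IH] q x /=; first by exists q; rewrite big_nil addr0; apply: run_nil.
case/andP=> qa /(IH a (x + abc_vec a))[q' r]; exists q'; rewrite big_cons addrA.
by apply: run_sym r => /=; rewrite qa; left.
Qed.

Lemma abc_runs_inv q x w q' y n : runs abc_aut q x w q' y n ->
  path leq q (map val w) /\ y = x + \sum_(a <- w) abc_vec a.
Proof.
elim=> {q x w q' y n} [q x|//|q x a q1 m w q' y n /=]; first by rewrite big_nil addr0.
by case: leqP => //= qa [] // [<- <-] _ [p ->]; rewrite big_cons addrA.
Qed.

Lemma abc_sum0 (w : seq 'I_3) : \sum_(a <- w) abc_vec a = 0 <->
  forall a b : 'I_3, count_mem a w = count_mem b w.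
Proof.
have S0 : (\sum_(a <- w) abc_vec a) 0 0 = (count_mem 0 w)%:Z - (count_mem 1 w)%:Z.
  elim: w => [|a w IH]; first by rewrite big_nil mxE.
  by rewrite big_cons mxE IH mxE /= !PoszD !natz; ring.
have S1 : (\sum_(a <- w) abc_vec a) 0 1 = (count_mem 1 w)%:Z - (count_mem (1 + 1) w)%:Z.
  elim: w {S0} => [|a w IH]; first by rewrite big_nil mxE.
  by rewrite big_cons mxE IH mxE /= !PoszD !natz; ring.
split=> [E|E].
  move: S0 S1; rewrite E !mxE => E0 E1.
  have {}E0 : count_mem 0 w = count_mem 1 w by lia.
  have {}E1 : count_mem 1 w = count_mem (1 + 1) w by lia.
  suff C a : count_mem a w = count_mem 1 w by move=> a b; rewrite !C.
  case: a => [[|[|[|//]]] h].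
  - by rewrite -E0; congr count; congr pred1; apply: val_inj.
  - by congr count; congr pred1; apply: val_inj.
  - by rewrite E1; congr count; congr pred1; apply: val_inj.
apply/rowP=> -[[|[|//]] h]; rewrite [RHS]mxE.
  by rewrite (_ : Ordinal h = 0) ?S0 ?(E 0 1) ?subrr //; apply: val_inj.
by rewrite (_ : Ordinal h = 1) ?S1 ?(E (1 + 1) 1) ?subrr //; apply: val_inj.
Qed.

Lemma abc_LGw_Zk2 : LGw (Zk 2) 'I_3 abc_lang.
Proof.
have path0 (s : seq nat) : path leq 0%N s = sorted leq s by case: s.
have acc w : abc_lang w -> accepts_in (Zk 2) 'I_3 abc_aut w (size w).
  case=> sw /abc_sum0 cw; have [|q' r] := @abc_runs ord0 0 w; first by rewrite path0.
  by exists q', (0 + \sum_(a <- w) abc_vec a); split=> //; split=> //=; rewrite cw addr0.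
apply/LGwP; exists abc_aut, 1%N; split=> w.
  split=> [/acc|]; first by exists (size w).
  case=> n [q [y [/abc_runs_inv[p ->] [_ E]]]]; split; first by rewrite -path0.
  by apply/abc_sum0; rewrite -[RHS]E /= add0r.
by move=> /acc; exists (size w); rewrite mul1n.
Qed.

Lemma abc_LGw_Zk k : (2 <= k)%N -> LGw (Zk k) 'I_3 abc_lang.
Proof. by move=> k2; apply: LGw_Zk2_Zk => //; apply: abc_LGw_Zk2. Qed.

Lemma not_csub_Zk_CF k : (2 <= k)%N -> ~ csub (LGw (Zk k)) CF.
Proof. by move=> /abc_LGw_Zk h /(_ _ _ h) /pumpable_CF; apply: not_pumpable_abc. Qed.

(** * Even palindromes *)

Definition palindrome_lang (w : seq bool) : Prop := exists u, w = u ++ rev u.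

Definition palindrome_rules : seq (unit * seq (unit + bool)) :=
  [:: (tt, [::]); (tt, [:: inr false; inl tt; inr false]); (tt, [:: inr true; inl tt; inr true])].

(** The invariant of a derivation: the nonterminal stands for an arbitrary even palindrome. *)
Fixpoint palindrome_sem (s : seq (unit + bool)) (w : seq bool) : Prop :=
  match s with
  | [::] => w = [::]
  | inr a :: s => exists2 v, w = a :: v & palindrome_sem s v
  | inl _ :: s => exists u v, w = (u ++ rev u) ++ v /\ palindrome_sem s v
  end.

Lemma palindrome_CF : CF bool palindrome_lang.
Proof.
exists unit, tt, palindrome_rules => w; split=> [[u ->]|d].
  elim: u => [|a u IH].
    apply: (@der_nt _ _ _ tt [::] [::] [::] [::]); [by left|exact: der_nil|exact: der_nil].
  rewrite rev_cons -cats1 /= -[a :: _]cats0.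
  apply: (@der_nt _ _ _ tt [:: inr a; inl tt; inr a]); last exact: der_nil.
    by case: a; [right; right; left|right; left].
  by apply: der_term; rewrite catA; apply: derives_cat IH _; apply: der_term; apply: der_nil.
suff : palindrome_sem [:: inl tt] w by case=> u [v [-> ->]]; exists u; rewrite cats0.
elim: d => {w} //= [a s w _ IH|X r s u v XP _ IHr _ IHs]; first by exists w.
suff [t ->] : exists t, u = t ++ rev t by exists t, v.
by move: XP IHr; do 3?[case=> [[_ <-] /=|]] => //;
  [exists [::] | case=> ? -> [t [? [-> [? -> ->]]]]; exists (false :: t) |
   case=> ? -> [t [? [-> [? -> ->]]]]; exists (true :: t)] => //;
  rewrite rev_cons -cats1 /= catA.
Qed.

(** The bit strings of length [n], each paired with its reverse, form a fooling set: equal lengths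
    force the two halves of a palindrome to match. *)
Lemma not_csub_CF_comm (G : grp) :
  (forall x a b, gmul G (gmul G x a) b = gmul G (gmul G x b) a) -> ~ csub CF (LGw G).
Proof.
move=> mulC /(_ _ _ palindrome_CF); apply: not_LGw_comm => // n.
exists (fun i => tval i), (fun i => rev i); split=> [i|i j [u E]|i].
- by exists i.
- have su : size u = n.
    by have /= := congr1 size E; rewrite !size_cat !size_rev !size_tuple; lia.
  have /eqP := E; rewrite eqseq_cat ?su ?size_tuple // => /andP[/eqP Ei /eqP /(can_inj revK) Ej].
  by apply: val_inj; apply: etrans Ei (esym Ej).
- by rewrite size_cat size_rev size_tuple; lia.
Qed.

Lemma CF_Zk_incomparable k : (2 <= k)%N -> cincomparable CF (LGw (Zk k)).
Proof.
move=> k2; split; last exact: not_csub_Zk_CF.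
by apply: not_csub_CF_comm => x a b /=; rewrite addrAC.
Qed.

(** * Powers of two over BS(1,2) *)

Notation lA := (false, false).
Notation lA' := (false, true).
Notation lB := (true, false).
Notation lB' := (true, true).

(** Inserting [lB' lB] after the first [lA] splits off one factor [b a b^-1 = a^2]. *)
Lemma BS12_double k : peq bool relBS (lB :: nseq k lA ++ [:: lB']) (nseq (2 * k) lA).
Proof.
elim: k => [|k IH]; first exact: (peq_cancel _ lB).
have baB : peq bool relBS [:: lB; lA; lB'] [:: lA; lA].
  apply: (@peq_trans _ _ _ ([:: lB; lA; lB'] ++ [:: lA'; lA'] ++ [:: lA; lA])).
    apply: peq_sym; rewrite -[X in peq _ _ _ X](cats0 [:: lB; lA; lB']).
    by apply: peq_catl; apply: (peq_winv relBS [:: lA'; lA']).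
  rewrite catA; apply: (peq_catr [:: lA; lA] (y := [::])).
  apply: peq_sym; apply: Relation_Operators.rst_step.
  by apply: (pstep_rel _ _ [::] [::] ([:: lB; lA; lB'] ++ [:: lA'; lA'])); left.
have -> : (2 * k.+1 = 2 + 2 * k)%N by lia.
apply: (@peq_trans _ _ _ ([:: lB; lA; lB'] ++ (lB :: nseq k lA ++ [:: lB']))).
  apply: peq_sym; apply: (peq_ctx [:: lB; lA] (nseq k lA ++ [:: lB']) (x := [:: lB'; lB]) (y := [::])).
  exact: (peq_cancel _ lB').
apply: peq_trans (peq_catl _ IH) _; exact: (peq_catr (nseq (2 * k) lA) baB).
Qed.

Lemma BS12_pow2 i : peq bool relBS (nseq i lB ++ lA :: nseq i lB') (nseq (2 ^ i) lA).
Proof.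
elim: i => [|i IH]; first exact: peq_refl.
rewrite expnS; apply: peq_trans (BS12_double _).
have -> : nseq i.+1 lB' = nseq i lB' ++ [:: lB'] by rewrite -addn1 nseqD.
have := peq_ctx [:: lB] [:: lB'] IH; by rewrite /= -catA /=.
Qed.

Definition pow2_delta (q : option bool) (a : option unit) : seq (option bool * seq (bool * bool)) :=
  match q, a with
  | None, None => [:: (None, [:: lB]); (Some false, [:: lA])]
  | Some false, None => [:: (Some false, [:: lB']); (Some true, [::])]
  | Some true, Some _ => [:: (Some true, [:: lA'])]
  | _, _ => [::]
  end.

(* Reads [a^m] and computes [b^i a b^(-j) a^(-m)], with [i] and [j] guessed. *)
Definition pow2_aut : gaut BS12 unit :=
  GAut BS12 unit _ None (pred1 (Some true)) pow2_delta (fun _ _ _ _ _ => I).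

(** Evaluate the affine action at [m = size w]: [a^-m] gives 0, which [b^-j] fixes, and [b^i a] then
    gives [2 ^ i]. The result does not depend on [j], so a wrong guess of [j] accepts nothing
    new. *)
Lemma pow2_runs_inv q x w q' y n : runs pow2_aut q x w q' y n -> q' = Some true ->
  match q with
  | None => exists i, act aff_BS y (size w)%:R = act aff_BS x (2 ^ i)%:R
  | Some false => act aff_BS y (size w)%:R = act aff_BS x 0
  | Some true => forall t, act aff_BS y t = act aff_BS x (t - (size w)%:R)
  end.
Proof.
elim=> {q x w q' y n}.
- by move=> q x -> t; rewrite subr0.
- move=> [[]|] x q1 m w q' y n //= [[<- <-]|[[<- <-]|//]] _ /[apply].
  + by rewrite act_cat /= mul0r.
  + by move=> ->; rewrite cats0 subrr.
  + by case=> i ->; exists i.+1; rewrite act_cat /= expnS natrM.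
  + by move=> ->; exists 0%N; rewrite act_cat /= add0r.
- move=> [[]|] x a q1 m w q' y n //= [[<- <-]|//] _ /[apply] E t.
  by rewrite E act_cat /= -addn1 natrD; congr (act _ _ _); ring.
Qed.

Lemma pow2_accepts i : accepts_in BS12 unit pow2_aut (nseq (2 ^ i) tt) (i + (1 + (i + (1 + 2 ^ i)))).
Proof.
have rB x : runs pow2_aut None x [::] None (x ++ nseq i lB) i.
  elim: i x => [|n IH] x; first by rewrite cats0; apply: run_nil.
  by have := IH (x ++ [:: lB]); rewrite -catA; apply: run_eps; left.
have rB' x : runs pow2_aut (Some false) x [::] (Some false) (x ++ nseq i lB') i.
  elim: i x {rB} => [|n IH] x; first by rewrite cats0; apply: run_nil.
  by have := IH (x ++ [:: lB']); rewrite -catA; apply: run_eps; left.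
have rA x n : runs pow2_aut (Some true) x (nseq n tt) (Some true) (x ++ nseq n lA') n.
  elim: n x => [|n IH] x; first by rewrite cats0; apply: run_nil.
  by have := IH (x ++ [:: lA']); rewrite -catA; apply: run_sym; left.
exists (Some true), ((([::] ++ nseq i lB) ++ [:: lA]) ++ nseq i lB' ++ nseq (2 ^ i) lA').
split; last first.
  split=> //=; rewrite catA.
  apply: peq_trans (peq_catr _ (y := nseq (2 ^ i) lA) _) _; first by rewrite -catA; apply: BS12_pow2.
  have -> : nseq (2 ^ i) lA' = winv bool (nseq (2 ^ i) lA).
    by rewrite /winv map_nseq; move: (2 ^ i)%N => n; elim: n => // n IH; rewrite -{2}addn1 nseqD rev_cat -IH.
  exact: peq_winv.
have rBA x : runs pow2_aut None x [::] (Some false) (x ++ [:: lA]) 1.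
  by apply: run_eps (run_nil _ _ _ _ _); right; left.
have rBA' x : runs pow2_aut (Some false) x [::] (Some true) (x ++ [::]) 1.
  by apply: run_eps (run_nil _ _ _ _ _); right; left.
have := runs_cat (rB [::]) (runs_cat (rBA _) (runs_cat (rB' _)
  (runs_cat (rBA' _) (rA _ (2 ^ i)%N)))).
by rewrite cats0 -!catA.
Qed.

Lemma pow2_LGw_BS12 : LGw BS12 unit pow2_lang.
Proof.
have nseqE (w : seq unit) : w = nseq (size w) tt by elim: w => //= -[] w {1}->.
apply/LGwP; exists pow2_aut, 3%N; split=> w.
  split=> [[i sw]|[n [q [y [r [/eqP qE y1]]]]]].
    by rewrite (nseqE w) sw; eexists; apply: pow2_accepts.
  have [i] := pow2_runs_inv r qE; rewrite (peq_act aff_BSK aff_BSR _ y1) /= => /eqP.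
  by rewrite eqr_nat => /eqP; exists i.
case=> i sw; rewrite (nseqE w) sw; exists (i + (1 + (i + (1 + 2 ^ i))))%N.
split; last exact: pow2_accepts.
(* Since [i < 2 ^ i], the [2 * i + 2] silent steps are linear in the length. *)
by rewrite size_nseq; have := @ltn_expl 2 i isT; lia.
Qed.

Lemma not_csub_BS12_CF : ~ csub (LGw BS12) CF.
Proof. by move=> /(_ _ _ pow2_LGw_BS12) /pumpable_CF; apply: not_pumpable_pow2. Qed.

(** * Regular languages and the trivial group *)

Lemma Free0_nil (w : seq ('I_0 * bool)) : w = [::].
Proof. by case: w => // -[[]]. Qed.

Section Regular.
Variables (Sigma : finType) (A : gaut (Free 0) Sigma).

Definition nstep (a : option Sigma) : rel (gQT A) :=
  fun q q' => has (fun p => p.1 == q') (gdelta A q a).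

Lemma nstepP a q q' : reflect (exists m, List.In (q', m) (gdelta A q a)) (nstep a q q').
Proof.
apply: (iffP hasP) => [[[q1 m] /mem_In h /= /eqP <-]|[m /mem_In h]]; first by exists m.
by exists (q', m) => /=.
Qed.

Definition eclose (P : {set gQT A}) : {set gQT A} :=
  [set q | [exists p in P, connect (nstep None) p q]].

Definition dstep (P : {set gQT A}) (a : Sigma) : {set gQT A} :=
  eclose [set q | [exists p in P, nstep (Some a) p q]].

Lemma run_epsilon q q' x : connect (nstep None) q q' -> exists n, runs A q x [::] q' [::] n.
Proof.
case/connectP=> p; elim: p q x => [|q1 p IH] q x /=.
  by move=> _ ->; exists 0%N; rewrite (Free0_nil x); apply: run_nil.
case/andP=> /nstepP[m h] /IH{}IH /(IH (gmul _ x m))[n r]; exists n.+1; exact: run_eps h r.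
Qed.

(** Correctness of the subset construction; [eclose] absorbs the silent moves at the start and after
    each letter. *)
Lemma mem_dfold w P q' : q' \in foldl dstep (eclose P) w <->
  exists q n, q \in P /\ runs A q [::] w q' [::] n.
Proof.
split.
  elim: w P => [|a w IH] P /=.
    rewrite inE => /exists_inP[q qP /(run_epsilon [::])[n r]]; by exists q, n.
  move/IH=> [q [n []]]; rewrite inE => /exists_inP[p]; rewrite inE => /exists_inP[q0 q0P].
  move=> /(run_epsilon [::])[n0 r0] /nstepP[m h] r; exists q0, (n0 + n.+1)%N; split=> //.
  apply: runs_cat r0 _; apply: run_sym h _; by rewrite (Free0_nil (gmul (Free 0) _ _)).
case=> q [n [qP r]]; have : q \in eclose P.
  by rewrite inE; apply/exists_inP; exists q.
elim: r P {qP} => {q w q' n} [q x|q x q1 m w q' y n h _ IH|q x a q1 m w q' y n h _ IH] P //.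
  rewrite inE => /exists_inP[p pP pq]; apply: IH; rewrite inE; apply/exists_inP; exists p => //.
  by apply: connect_trans pq (connect1 _); apply/nstepP; exists m.
move=> qP; apply: IH; rewrite inE; apply/exists_inP; exists q1 => //.
by rewrite inE; apply/exists_inP; exists q => //; apply/nstepP; exists m.
Qed.

Lemma REG_gaccepts : REG Sigma (gaccepts (Free 0) Sigma A).
Proof.
exists {set gQT A}, (eclose [set gq0 A]), [pred P : {set gQT A} | [exists q in P, gacc A q]], dstep.
move=> w; split=> [[n [q [y [r [acc _]]]]]|/exists_inP[q /mem_dfold[q0 [n [/set1P -> r]]] acc]].
  apply/exists_inP; exists q => //; apply/mem_dfold; exists (gq0 A), n.
  by split; [exact: set11|move: r; rewrite (Free0_nil y)].
by exists n, q, [::]; split=> //; split=> //; apply: peq_refl.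
Qed.

End Regular.

Section FiniteAutomaton.
Variables (Sigma Q : finType) (s : Q) (F : pred Q) (d : Q -> Sigma -> Q).

Definition dfa_delta (q : Q) (a : option Sigma) : seq (Q * seq ('I_0 * bool)) :=
  if a is Some a then [:: (d q a, [::])] else [::].

Definition dfa_aut : gaut (Free 0) Sigma :=
  GAut (Free 0) Sigma Q s F dfa_delta (fun _ _ _ _ _ => I).

Lemma dfa_runs q w : runs dfa_aut q [::] w (foldl d q w) [::] (size w).
Proof.
elim: w q => [|a w IH] q; first exact: run_nil.
by apply: (@run_sym _ _ dfa_aut q [::] a (d q a) [::]); [left|exact: IH].
Qed.

Lemma dfa_runs_inv q x w q' y n : runs dfa_aut q x w q' y n -> q' = foldl d q w.
Proof. by elim=> {q x w q' y n} // q x a q1 m w q' y n [[<- _]|[]]. Qed.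

End FiniteAutomaton.

Lemma REG_Free0 : ceq REG (LGw (Free 0)).
Proof.
split=> Sigma L.
  case=> Q [s [F [d LP]]]; apply/LGwP; exists (dfa_aut s F d), 1%N.
  have acc w : L w -> accepts_in (Free 0) Sigma (dfa_aut s F d) w (size w).
    move=> /LP Fw; exists (foldl d s w), [::]; split; first exact: dfa_runs.
    by split=> //; apply: peq_refl.
  split=> w.
    split=> [/acc|[n [q [y [/dfa_runs_inv -> [Fw _]]]]]]; first by exists (size w).
    exact/LP.
  by move=> /acc; exists (size w); rewrite mul1n.
case=> A [t [_ [recL _]]]; have [Q [s [F [d LP]]]] := REG_gaccepts A.
by exists Q, s, F, d => w; rewrite recL.
Qed.

(** With a trivial register an automaton with [N] states has [N] configurations, while the word
    problem of the infinite cyclic group has fooling sets of size [N + 1] made of powers of the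
    generator. *)
Lemma cstrict_Free0_Free1 : cstrict (LGw (Free 0)) (LGw (Free 1)).
Proof.
split.
  apply: (@LGw_hom (Free 0) (Free 1) (fun _ => [::]) (fun _ y => y = [::])) => //.
    by move=> x y m _ ->.
  by move=> x y ->; rewrite (Free0_nil x); split=> _; apply: peq_refl.
pose p (b : bool) : gcar (Free 1) := [:: (ord0, b)].
have congF := @congruent_pres 'I_1 [::].
have mulK (x : gcar (Free 1)) b : geq (Free 1) (gmul (Free 1) (gmul (Free 1) x (p b)) (p (~~ b))) x.
  exact: (peq_mulK [::] x (p b)).
exists bool, (WP p); split; first exact: LGw_WP.
case/LGwP=> A [c [recL timeL]]; set N := #|gQT A|.
have uE m x : wprod (G := Free 1) p x (nseq m true) = x ++ nseq m (ord0, true).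
  elim: m x => [|m IH] x; first by rewrite cats0.
  have -> : wprod (G := Free 1) p x (nseq m.+1 true) =
    wprod (G := Free 1) p (x ++ [:: (ord0, true)]) (nseq m true) by [].
  by rewrite IH -catA.
have := @fooling_bound (Free 0) bool _ A c (2 * N) 'I_N.+1 unit (fun i => nseq i true)
  (fun i => map negb (rev (nseq i true))) (fun _ _ => True) recL timeL.
rewrite card_unit muln1 card_ord => h; suff : (N < N)%N by rewrite ltnn.
apply: h => [i|i j|i|_ x y _ _|w q x n _ _].
- exact: (WP_inv congF mulK).
- move=> /WP_fooling h; have {h} := h congF negbK mulK; rewrite !uE /= => h.
  have := peq_act (@translK _ (ord0 : 'I_1)) _ 0 h.
  have sE m : act (transl (ord0 : 'I_1)) (nseq m (ord0, true)) 0 = - m%:R.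
    elim: m => [|m IH] /=; first by rewrite oppr0.
    by rewrite IH /transl /= expr1 -[m.+1]addn1 natrD opprD.
  rewrite !sE => /(_ (fun _ F => False_ind _ F)) /oppr_inj /eqP; rewrite eqr_nat => /eqP.
  exact: val_inj.
- by rewrite size_cat size_map size_rev size_nseq; have := ltn_ord i; lia.
- by rewrite (Free0_nil x) (Free0_nil y).
- by exists tt.
Qed.

(** * The amalgam structure of SL(2,Z) *)

(** These are [S] for [true], of order 4, and [U] for [false], of order 6, with [S^2 = U^3 = -1]. *)
Definition sl2_letter (b : bool) : 'M[int]_2 := if b then mk2 0 (-1) 1 0 else mk2 0 (-1) 1 1.

Definition sl2_word (s : seq bool) : 'M[int]_2 := foldr (fun b M => sl2_letter b *m M) 1%:M s.

Lemma sl2_word_cat s t : sl2_word (s ++ t) = sl2_word s *m sl2_word t.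
Proof. by elim: s => [|b s IH] /=; rewrite ?mul1mx // IH mulmxA. Qed.

Lemma mulz_eq1 (a d : int) : a * d = 1 -> (a = 1 /\ d = 1) \/ (a = -1 /\ d = -1).
Proof.
move=> ad; have /eqP : (`|a| * `|d| = 1)%N by rewrite -abszM ad.
rewrite muln_eq1 => /andP[/eqP a1 /eqP d1]; move: ad a1 d1.
by case: (lerP 0 a); case: (lerP 0 d) => hd ha ad a1 d1; [left|exfalso|exfalso|right]; nia.
Qed.

(** The products of letters contain -1 and the unit shear with its inverse; Euclid's algorithm on
    the first column does the rest. *)
Lemma sl2_generated (M : 'M[int]_2) : \det M = 1 -> exists s, sl2_word s = M.
Proof.
pose H (M : 'M[int]_2) := exists s, sl2_word s = M.
have HM X Y : H X -> H Y -> H (X *m Y) by case=> s <- [t <-]; exists (s ++ t); rewrite sl2_word_cat.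
have HS : H (mk2 0 (-1) 1 0) by exists [:: true]; rewrite /= mulmx1.
have HU : H (mk2 0 (-1) 1 1) by exists [:: false]; rewrite /= mulmx1.
have HN : H (mk2 (-1) 0 0 (-1)).
  by have := HM _ _ HS HS; rewrite mul_mk2; congr (H (mk2 _ _ _ _)); lia.
have HT : H (mk2 1 1 0 1).
  have := HM _ _ HN (HM _ _ HS HU); rewrite !mul_mk2; congr (H (mk2 _ _ _ _)); lia.
have HT' : H (mk2 1 (-1) 0 1).
  have := HM _ _ HN (HM _ _ HU (HM _ _ HU HS)); rewrite !mul_mk2; congr (H (mk2 _ _ _ _)); lia.
have HTq q : H (mk2 1 q 0 1).
  elim/int_ind: q => [|n IH|n IH].
  - by exists [::]; rewrite /= mk2_1.
  - have := HM _ _ HT IH; rewrite mul_mk2; congr (H (mk2 _ _ _ _)); lia.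
  - have := HM _ _ HT' IH; rewrite mul_mk2; congr (H (mk2 _ _ _ _)); lia.
rewrite (mk2E M); move: (M 0 0) (M 0 1) (M 1 0) (M 1 1) => a b c d {M}.
have [n] := ubnP `|c|%N; elim: n a b c d => // n IH a b c d le_c; rewrite det_mk2 => dt.
have [c0|c0] := eqVneq c 0.
  have : (a = 1 /\ d = 1) \/ (a = -1 /\ d = -1).
    by apply: mulz_eq1; move: dt; rewrite c0 mulr0 subr0.
  rewrite c0 => -[[-> ->]|[-> ->]]; first exact: HTq.
  have := HM _ _ HN (HTq (- b)); rewrite mul_mk2; congr (H (mk2 _ _ _ _)); lia.
(* Factor out the shear by [q] and [S]: up to sign, the new lower left entry is the remainder of [a]
   modulo [c]. *)
pose q := (a %/ c)%Z; have Ea := divz_eq a c; have rc := ltz_mod a c0; have r0 := modz_ge0 a c0.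
have -> : mk2 a b c d = mk2 1 q 0 1 *m (mk2 0 (-1) 1 0 *m mk2 c d (- (a - q * c)) (- (b - q * d))).
  by rewrite !mul_mk2; congr mk2; ring.
apply: (HM _ _ (HTq q)); apply: HM HS _; apply: IH; last by rewrite det_mk2 -dt; ring.
by rewrite /q; lia.
Qed.

Lemma sl2_word_choice : exists word : 'M[int]_2 -> seq bool,
  forall M, \det M = 1 -> sl2_word (word M) = M.
Proof.
have ex (M : 'M[int]_2) : \det M = 1 -> exists s, sl2_word s == M.
  by move=> /sl2_generated[s <-]; exists s.
exists (fun M => if \det M =P 1 is ReflectT h then xchoose (ex M h) else [::]) => M dM.
by case: eqP => // h; apply/eqP/(xchooseP (ex M h)).
Qed.

(** The amalgamated subgroup {+-1}. *)
Definition trivial2 (M : 'M[int]_2) := (M == mk2 1 0 0 1) || (M == mk2 (-1) 0 0 (-1)).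

(* In the free amalgam [<S> *_{+-1} <U>] this is the set of elements whose normal
   form starts with [S], together with [+-1]. *)
Definition starts_S (M : 'M[int]_2) := (0 <= M 0 0 * M 1 0) && (0 <= M 0 1 * M 1 1).

Lemma starts_S_mk2 a b c d : starts_S (mk2 a b c d) = (0 <= a * c) && (0 <= b * d).
Proof. by rewrite /starts_S !mxE. Qed.

(** The columns lie in the double cone [x * y >= 0]. If they are in opposite quadrants, so is their
    difference in the cone. In the same quadrant, [b - a] and [d - c] of opposite signs would make
    the determinant negative or at least [1 + |b| + |c|], which forces [b = c = 0]. *)
Lemma cone_shear (a b c d : int) : a * d - b * c = 1 -> 0 <= a * c -> 0 <= b * d ->
  ~~ trivial2 (mk2 a b c d) -> 0 <= (b - a) * (d - c).
Proof.
move=> dt ac bd /norP[/eqP n1 /eqP n2].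
have {}n1 : ~ (b = 0 /\ c = 0).
  case=> b0 c0; move: dt; rewrite b0 c0 mul0r subr0 => /mulz_eq1[[a1 d1]|[a1 d1]].
    by apply: n1; rewrite a1 b0 c0 d1.
  by apply: n2; rewrite a1 b0 c0 d1.
rewrite leNgt; apply/negP => neg.
have [bc|bc|bc] := ltrgtP (b * c) 0; first by nia.
  have ad : a * d = b * c + 1 by rewrite -dt; ring.
  have [b0|b0] : 0 < b \/ b < 0 by nia.
    have c0 : 0 < c by nia.
    have a0 : 0 < a by nia.
    have d0 : 0 < d by nia.
    have [ab|ab] : a < b \/ b < a by nia.
      have dc : d < c -> False by move=> dc; nia.
      nia.
    have cd : c < d -> False by move=> cd; nia.
    nia.
  have c0 : c < 0 by nia.
  have a0 : a < 0 by nia.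
  have d0 : d < 0 by nia.
  have [ab|ab] : a < b \/ b < a by nia.
    have cd : d < c -> False by move=> cd; nia.
    nia.
  have cd : c < d -> False by move=> cd; nia.
  nia.
move/eqP: (bc); rewrite mulf_eq0 => /orP[/eqP b0|/eqP c0].
  have [[a1 d1]|[a1 d1]] : (a = 1 /\ d = 1) \/ (a = -1 /\ d = -1).
  - by apply: mulz_eq1; rewrite -dt b0; ring.
  - by move: ac neg; rewrite a1 d1 b0 => ac neg; apply: n1; rewrite b0; lia.
  - by move: ac neg; rewrite a1 d1 b0 => ac neg; apply: n1; rewrite b0; lia.
have [[a1 d1]|[a1 d1]] : (a = 1 /\ d = 1) \/ (a = -1 /\ d = -1).
- by apply: mulz_eq1; rewrite -dt c0; ring.
- by move: bd neg; rewrite a1 d1 c0 => bd neg; apply: n1; rewrite c0; lia.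
- by move: bd neg; rewrite a1 d1 c0 => bd neg; apply: n1; rewrite c0; lia.
Qed.

(** Right multiplication by [S] swaps the columns up to sign. Right multiplication by [U] turns
    columns [x], [y] into [y], [y - x]; one direction is [cone_shear] for [M], the other is
    [cone_shear] for the product. *)
Lemma starts_S_letter (M : 'M[int]_2) b : \det M = 1 -> ~~ trivial2 M ->
  ~~ trivial2 (M *m sl2_letter b) -> starts_S (M *m sl2_letter b) = starts_S M.
Proof.
rewrite (mk2E M); move: (M 0 0) (M 0 1) (M 1 0) (M 1 1) => p q r s {M}.
rewrite det_mk2 /sl2_letter => dt n1; case: b; rewrite mul_mk2.
  by move=> _; rewrite !starts_S_mk2 !(mulr0, mulr1, addr0, add0r) andbC; congr andb; congr (0 <= _); ring.
rewrite !(mulr0, mulr1, add0r, mulrN1) => n2; rewrite !starts_S_mk2.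
have E1 : (- p + q) * (- r + s) = (q - p) * (s - r) by ring.
apply/andP/andP=> -[h1 h2]; split=> //; last by rewrite E1; apply: cone_shear h1 h2 n1.
have := @cone_shear q (- p + q) s (- r + s) _ h1 h2 n2.
have -> : (- p + q - q) * (- r + s - s) = p * r by ring.
by apply; rewrite -dt; ring.
Qed.

(** * A grammar for automata over SL(2,Z) *)

(** The union of <S> and <U>, which meet in {+-1}. *)
Definition sl2_vertex : seq 'M[int]_2 :=
  [:: mk2 1 0 0 1; mk2 (-1) 0 0 (-1); mk2 0 (-1) 1 0; mk2 0 1 (-1) 0;
      mk2 0 (-1) 1 1; mk2 0 1 (-1) (-1); mk2 (-1) (-1) 1 0; mk2 1 1 (-1) 0].

Lemma eq_mk2 (R : comNzRingType) (a b c d a' b' c' d' : R) :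
  (mk2 a b c d == mk2 a' b' c' d') = [&& a == a', b == b', c == c' & d == d'].
Proof. by apply/eqP/and4P=> [/mk2_inj[-> -> -> ->]|[/eqP-> /eqP-> /eqP-> /eqP->]]. Qed.

Lemma trivial2_vertex h : trivial2 h ->
  [/\ h \in sl2_vertex, h *m h = 1%:M & forall g, g \in sl2_vertex -> h *m g \in sl2_vertex].
Proof.
case/orP=> /eqP ->; split; rewrite ?mul_mk2 ?mk2_1 ?inE ?eq_mk2 //.
  by move=> g; rewrite -mk2_1 mul1mx.
by move=> g; rewrite !inE => /or4P[|||/or4P[|||/orP[]]] /eqP ->; rewrite mul_mk2 !eq_mk2.
Qed.

(* A generator and an element of [<S> u <U>] either lie in a common factor, or
   are separated by [+-1] in the Cayley graph. *)
Lemma sl2_vertex_split b g : g \in sl2_vertex ->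
  (exists z, [/\ z *m sl2_letter b = 1%:M, sl2_letter b *m z = 1%:M & z *m g \in sl2_vertex]) \/
  ~~ trivial2 g /\ starts_S (sl2_letter b) != starts_S g.
Proof.
have [z [zl lz]] : exists z, [/\ z *m sl2_letter b = 1%:M, sl2_letter b *m z = 1%:M
    & z = if b then mk2 0 1 (-1) 0 else mk2 1 1 (-1) 0].
  by case: b; eexists; split=> //; rewrite mk2_1 mul_mk2; apply/eqP; rewrite eq_mk2.
move=> Ez gB; suff: (z *m g \in sl2_vertex) || ~~ trivial2 g && (starts_S (sl2_letter b) != starts_S g).
  by case/orP=> [h|/andP[h1 h2]]; [left; exists z|right].
move: gB; rewrite Ez /sl2_letter /trivial2 !inE.
by case: b {Ez zl lz} => /or4P[|||/or4P[|||/orP[]]] /eqP ->; rewrite mul_mk2 !eq_mk2 !starts_S_mk2.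
Qed.

Lemma trivial2_letter b : ~~ trivial2 (sl2_letter b).
Proof. by case: b; rewrite /trivial2 !eq_mk2. Qed.

Section SL2Grammar.
Variables (Sigma : finType) (A : gaut (SL int 2) Sigma).
Variable word : 'M[int]_2 -> seq bool.
Hypothesis wordE : forall M, \det M = 1 -> sl2_word (word M) = M.

Let trans : seq 'M[int]_2 := transitions A.
Let K := (\max_(i < size trans) size (word (nth 1%:M trans i)))%N.

(* A state [(q, s)] records that the word [s] of generators remains to be
   multiplied before the original automaton reaches [q]. *)
Let E : finType := (gQT A * K.-bseq bool)%type.

Let final (q : gQT A) : E := (q, [bseq]).

(** A transition is first loaded, with the register unchanged, and then multiplied in one generator
    at a time, so the register follows edges of the Cayley graph. *)
Definition estep (e : E) (a : option Sigma) (m : 'M[int]_2) (e' : E) : Prop :=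
  (m = 1%:M /\ exists m0, [/\ e.2 = [::] :> seq bool, List.In (e'.1, m0) (gdelta A e.1 a)
     & e'.2 = word m0 :> seq bool])
  \/ exists b, [/\ a = None, e.1 = e'.1, e.2 = b :: e'.2 :> seq bool & m = sl2_letter b].

Definition olist (a : option Sigma) : seq Sigma := if a is Some a then [:: a] else [::].

Inductive eruns : E -> 'M[int]_2 -> seq Sigma -> E -> 'M[int]_2 -> nat -> Prop :=
| eruns_nil e x : eruns e x [::] e x 0
| eruns_step e x a m e1 w e' y n : estep e a m e1 -> eruns e1 (x *m m) w e' y n ->
    eruns e x (olist a ++ w) e' y n.+1.

Lemma eruns_cat e x u e1 x1 n1 v e2 x2 n2 :
  eruns e x u e1 x1 n1 -> eruns e1 x1 v e2 x2 n2 -> eruns e x (u ++ v) e2 x2 (n1 + n2)%N.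
Proof.
move=> r1 r2; elim: r1 r2 => //= {e x u e1 x1 n1} e x a m e1 w e' y n st _ IH /IH.
by rewrite -catA; apply: eruns_step.
Qed.

(** Translation invariance: every piece of a run can be restarted at the identity, so a label only
    needs the quotient of its end registers. *)
Lemma eruns_mull z e x w e' y n : eruns e x w e' y n -> eruns e (z *m x) w e' (z *m y) n.
Proof.
elim=> {e x w e' y n} [e x|e x a m e1 w e' y n st _ IH]; first exact: eruns_nil.
by apply: eruns_step st _; rewrite -mulmxA.
Qed.

Lemma eruns_runs e x w e' y n : eruns e x w e' y n -> e'.2 = [::] :> seq bool ->
  exists n', runs A e.1 (x *m sl2_word e.2 : 'M[int]_2) w e'.1 y n'.
Proof.
elim=> {e x w e' y n} [e x ->|e x a m e1 w e' y n st _ IH /IH{IH}[n' r]].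
  by exists 0%N; rewrite /= mulmx1; apply: run_nil.
case: st r => [[-> [m0 [-> hin ->]]]|[b [-> -> -> ->]]] r; last first.
  by exists n'; rewrite /= mulmxA.
exists n'.+1; move: r; rewrite mulmx1 wordE; last exact: (@gdelta_mem _ _ A _ _ _ _ hin).
rewrite /= ?mulmx1; by case: a hin => [a|] hin r; [apply: run_sym hin r|apply: run_eps hin r].
Qed.

Lemma eruns_word q (s : K.-bseq bool) x : exists n,
  eruns (q, s) x [::] (final q) (x *m sl2_word s) n.
Proof.
case: s => s; elim: s x => [|b s IH] x sK.
  exists 0%N; rewrite /= mulmx1 (_ : Bseq sK = [bseq]); first exact: eruns_nil.
  exact: val_inj.
have sK' : (size s <= K)%N by apply: ltnW.
have [n r] := IH (x *m sl2_letter b) sK'; exists n.+1; move: r; rewrite -mulmxA.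
apply: (@eruns_step (q, Bseq sK) x None (sl2_letter b) (q, Bseq sK') [::]).
by right; exists b.
Qed.

Lemma runs_eruns q x w q' y n : runs A q x w q' y n ->
  exists n', eruns (final q) x w (final q') y n'.
Proof.
have step q0 a q1 m (x0 : 'M[int]_2) : List.In (q1, m) (gdelta A q0 a) -> exists n,
    eruns (final q0) x0 (olist a) (final q1) (x0 *m m) n.
  move=> hin; have [i hi Em] := transitionsP hin.
  have sK : (size (word m) <= K)%N.
    rewrite -[m in word m]Em.
    exact: (leq_bigmax (F := fun i : 'I_(size trans) => size (word (nth 1%:M trans i))) (Ordinal hi)).
  have [n0 r] := eruns_word q1 (Bseq sK) x0; exists n0.+1; rewrite -[olist a]cats0.
  move: r; rewrite wordE; last exact: (@gdelta_mem _ _ A _ _ _ _ hin).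
  rewrite -{1}[x0]mulmx1; apply: eruns_step; left; split=> //; by exists m.
elim=> {q x w q' y n} [q x|q x q1 m w q' y n hin _ [n2 r2]|q x a q1 m w q' y n hin _ [n2 r2]].
- by exists 0%N; apply: eruns_nil.
- by have [n1 r1] := step _ _ _ _ x hin; exists (n1 + n2)%N; apply: eruns_cat r1 r2.
- by have [n1 r1] := step _ _ _ _ x hin; exists (n1 + n2)%N; apply: eruns_cat r1 r2.
Qed.

Lemma estep_letter e a m e' : estep e a m e' -> m = 1%:M \/ exists b, m = sl2_letter b.
Proof. by case=> [[-> _]|[b [_ _ _ ->]]]; [left|right; exists b]. Qed.

Lemma det_sl2_letter b : \det (sl2_letter b) = 1.
Proof. by case: b; rewrite det_mk2; ring. Qed.

(** By [starts_S_letter] an edge between elements other than +-1 preserves [starts_S], so a path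
    along which it changes visits +-1. *)
Lemma eruns_cross e x w e' y n : eruns e x w e' y n -> \det x = 1 ->
  ~~ trivial2 x -> starts_S x != starts_S y ->
  exists w1 w2 e1 h n1 n2, [/\ w = w1 ++ w2, n = (n1 + n2)%N, trivial2 h,
    eruns e x w1 e1 h n1 & eruns e1 h w2 e' y n2].
Proof.
elim=> {e x w e' y n} [e x|e x a m e1 w e' y n st r IH] dx nx; first by rewrite eqxx.
have r1 := eruns_step st (eruns_nil e1 (x *m m)); rewrite cats0 in r1.
have [tm _|ntm] := boolP (trivial2 (x *m m)).
  by exists (olist a), w, e1, (x *m m), 1%N, n.
have -> : starts_S x = starts_S (x *m m).
  case: (estep_letter st) ntm => [->|[b ->]] ntm; first by rewrite mulmx1.
  by rewrite starts_S_letter.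
have dm : \det (x *m m) = 1.
  by rewrite det_mulmx dx mul1r; case: (estep_letter st) => [->|[b ->]]; rewrite ?det1 ?det_sl2_letter.
move=> /(IH dm ntm)[w1 [w2 [e2 [h [n1 [n2 [-> -> th r2 r3]]]]]]].
exists (olist a ++ w1), w2, e2, h, n1.+1, n2; split=> //; first by rewrite catA.
exact: eruns_step st r2.
Qed.

Definition sl2_leaf (i : E * 'M[int]_2 * E) (w : seq Sigma) : Prop :=
  (i.1.1 = i.2 /\ i.1.2 = 1%:M /\ w = [::]) \/
  exists2 a, estep i.1.1 a i.1.2 i.2 & w = olist a.

Definition sl2_labels : seq (E * 'M[int]_2 * E) :=
  [seq (eg, e') | eg <- [seq (e, g) | e <- enum E, g <- sl2_vertex], e' <- enum E].

(** The element of the parent is confined to [sl2_vertex], which leaves finitely many branching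
    labels. *)
Definition sl2_rule (i j k : E * 'M[int]_2 * E) : Prop :=
  [/\ i.1.2 \in sl2_vertex, i.1.1 = j.1.1, j.2 = k.1.1, k.2 = i.2 & i.1.2 = j.1.2 *m k.1.2].

Lemma sl2_rule_label i j k : sl2_rule i j k -> i \in sl2_labels.
Proof.
by case: i => [[e g] e'] [/= gB _ _ _ _]; apply: allpairs_f; rewrite ?mem_enum //;
  apply: allpairs_f; rewrite ?mem_enum.
Qed.

Lemma btree_eruns i w : btree sl2_leaf sl2_rule i w -> forall x, exists n,
  eruns i.1.1 x w i.2 (x *m i.1.2) n.
Proof.
elim=> {i w} [[[e g] e'] w [[/= <- [-> ->]]|[a /= st ->]] x|
  [[e g] e'] [[e1 g1] e1'] [[e2 g2] e2'] u v [/= _ <- -> <- ->] _ IHu _ IHv x].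
- by exists 0%N; rewrite mulmx1; apply: eruns_nil.
- by exists 1%N; rewrite -[olist a]cats0; apply: eruns_step st (eruns_nil _ _).
- have [n1 r1] := IHu x; have [n2 r2] := IHv (x *m g1); exists (n1 + n2)%N.
  by rewrite mulmxA; apply: eruns_cat r1 r2.
Qed.

Lemma eruns_inv e x w e' y n : eruns e x w e' y n ->
  if n is n.+1 then exists a m e1 w',
    [/\ w = olist a ++ w', estep e a m e1 & eruns e1 (x *m m) w' e' y n]
  else [/\ e = e', w = [::] & x = y].
Proof. by case=> {e x w e' y n} // e x a m e1 w e' y n st r; exists a, m, e1, w. Qed.

(** Induction on the number of steps. The run is cut after its first step if that generator and [g]
    lie in a common factor, and otherwise at a visit to +-1. *)
Lemma eruns_btree n e w e' g : eruns e 1%:M w e' g n -> g \in sl2_vertex ->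
  btree sl2_leaf sl2_rule ((e, g), e') w.
Proof.
have [N] := ubnP n; elim: N n e w e' g => // N IH [|[|n]] e w e' g ltnN.
- by case/eruns_inv => -> -> <- _; apply: bt_leaf; left.
- case/eruns_inv => a [m [e1 [w' [-> st /eruns_inv[<- -> <-]]]]] _.
  by apply: bt_leaf; right; exists a; rewrite ?cats0 ?mul1mx.
case/eruns_inv => a [m [e1 [w' [-> st]]]]; rewrite mul1mx => r gB.
have leafm : btree sl2_leaf sl2_rule ((e, m), e1) (olist a).
  by apply: bt_leaf; right; exists a.
have cut z : z *m m = 1%:M -> m *m z = 1%:M -> z *m g \in sl2_vertex ->
    btree sl2_leaf sl2_rule ((e, g), e') (olist a ++ w').
  move=> zm mz zg; apply: bt_rule leafm (IH n.+1 e1 w' e' (z *m g) _ _ zg).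
  - by split=> //=; rewrite mulmxA mz mul1mx.
  - by move: ltnN; lia.
  - by have := eruns_mull z r; rewrite zm.
case: (estep_letter st) => [m1|[b mb]].
  by apply: (cut 1%:M); rewrite ?m1 ?mul1mx.
case: (sl2_vertex_split b gB) => [[z [zl lz zg]]|[ntg sg]].
  by apply: (cut z); rewrite ?mb.
have [|||w1 [w2 [e2 [h [n1 [n2 [-> En th r1 r2]]]]]]] := eruns_cross r.
- by rewrite mb det_sl2_letter.
- by rewrite mb trivial2_letter.
- by rewrite mb.
have [hB hh hg] := trivial2_vertex th.
(* The cut is strictly inside the run: otherwise [g] would be the trivial [h]. *)
have n2_gt0 : (0 < n2)%N.
  by case: n2 r2 {En} => // /eruns_inv[_ _ hE]; rewrite -hE th in ntg.
(* As [h] is its own inverse, the second piece carries [h *m g], again in [sl2_vertex]. *)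
rewrite catA; apply: (@bt_rule _ _ _ _ _ ((e, h), e2) ((e2, h *m g), e')).
- by split=> //=; rewrite mulmxA hh mul1mx.
- apply: (IH n1.+1) => //; first by move: ltnN En n2_gt0; lia.
  by apply: eruns_step st _; rewrite mul1mx.
- apply: (IH n2) (hg _ gB); first by move: ltnN En; lia.
  by have := eruns_mull h r2; rewrite hh.
Qed.

Lemma pumpable_gaccepts_SL2Z : pumpable (gaccepts (SL int 2) Sigma A).
Proof.
apply: pumpable_ext (@pumpable_btree _ _ sl2_leaf sl2_rule sl2_labels _ sl2_rule_label
  (fun i => exists2 q, gacc A q & i = ((final (gq0 A), 1%:M), final q))) => [w|i w]; last first.
  by case=> [[_ [_ ->]]|[[a|] _ ->]].
split=> [[_ [q aq ->] /btree_eruns/(_ 1%:M)[n /= /eruns_runs/(_ erefl)[n' r]]]|].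
  by exists n', q, 1%:M; split=> //; move: r; rewrite /= !mulmx1.
case=> n [q [y [r [aq /= y1]]]]; move: r; rewrite y1 => /runs_eruns[n' r].
exists (final (gq0 A), 1%:M, final q); first by exists q.
by apply: eruns_btree r _; rewrite mk2_1 inE eqxx.
Qed.

End SL2Grammar.

Lemma pumpable_SL2Z (Sigma : finType) (L : seq Sigma -> Prop) : LGw (SL int 2) Sigma L -> pumpable L.
Proof.
case=> A [t [_ [recL _]]]; have [word wordE] := sl2_word_choice.
apply: pumpable_ext (pumpable_gaccepts_SL2Z A wordE) => w; exact: iff_sym.
Qed.

Lemma cstrict_SL2Z_SL3Z : cstrict (LGw (SL int 2)) (LGw (SL int 3)).
Proof.
split; first exact: LGw_SL2_SL3.
exists 'I_3, abc_lang; split; last by move/pumpable_SL2Z; apply: not_pumpable_abc.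
by apply: LGw_Heis_SL3; apply: LGw_Zk2_Heis; apply: abc_LGw_Zk2.
Qed.

Theorem theorem4p16 :
  (* (i) *)
  cstrict (LGw Qplus) (LGw (SL rat 2)) /\
  (* (ii) *)
  (cstrict (LGw Zgrp) (LGw BS12) /\ ~ csub (LGw BS12) CF) /\
  (* (iii) *)
  cstrict (LGw (SL int 2)) (LGw (SL int 3)) /\
  (* (iv) *)
  cstrict (LGw (Zk 2)) (LGw Heis) /\
  (* (v) *)
  (forall k : nat, (2 <= k)%N -> cincomparable CF (LGw (Zk k))) /\
  (* (vi) *)
  ceq (LGw (SL int 3)) (LGw (GLZ 3)) /\
  (* (vii) *)
  (ceq REG (LGw (Free 0)) /\ cstrict (LGw (Free 0)) (LGw (Free 1)) /\
   ceq (LGw (Free 1)) (LGw Zgrp) /\ cstrict (LGw Zgrp) (LGw (Free 2))).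
Proof.
split; first exact: cstrict_Qplus_SL2Q.
split; first by split; [exact: cstrict_Z_BS12|exact: not_csub_BS12_CF].
split; first exact: cstrict_SL2Z_SL3Z.
split; first exact: cstrict_Zk2_Heis.
split; first exact: CF_Zk_incomparable.
split; first exact: LGw_GLZ3_SL3.
split; first exact: REG_Free0.
split; first exact: cstrict_Free0_Free1.
split; last exact: cstrict_Z_Free2.
by split; [exact: LGw_Free1_Z|exact: LGw_Z_free].
Qed.
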